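(* Let $\rho$ be the unique real root of $x^3 = x+1$ and let $\lambda^* := \rho^{1/2} + \rho^{-1/2}$ ($\approx 2.01980$). For every $\lambda > 2$, the negative number $-\lambda$ is a limit point of the set of smallest eigenvalues of graphs if and only if $\lambda \ge \lambda^*$.
   Context: Graphs are finite, simple and undirected. Eigenvalues of a graph are those of its adjacency matrix. The set of smallest eigenvalues of graphs is the set of all real numbers that occur as the smallest eigenvalue of some graph; limit points are taken in $\mathbb{R}$. *)

(* Defs.v *)
From mathcomp Require Import all_boot all_order all_algebra.
From mathcomp Require Import all_classical all_reals all_analysis.

Set Implicit Arguments.
Unset Strict Implicit.
Unset Printing Implicit Defensive.

Import Order.TTheory GRing.Theory Num.Theory.
Import numFieldNormedType.Exports.

Local Open Scope classical_set_scope.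
Local Open Scope ring_scope.

Record sgraph := SGraph {
  vertex : finType;
  adj : rel vertex;
  adj_sym : symmetric adj;
  adj_irr : irreflexive adj
}.

(* Rows and columns follow the order of enum (vertex G); the spectrum does not
   depend on it. *)
Definition adjmx (R : realType) (G : sgraph) : 'M[R]_#|vertex G| :=
  \matrix_(i, j) (@adj G (enum_val i) (enum_val j))%:R.

(* The graph with no vertex has no eigenvalue, hence no smallest eigenvalue.
   Real eigenvalues are all of them, since adjmx is symmetric. *)
Definition is_smallest_eigenvalue (R : realType) (G : sgraph) (a : R) : Prop :=
  eigenvalue (adjmx R G) a /\ forall b : R, eigenvalue (adjmx R G) b -> a <= b.

Definition smallest_eigenvalues (R : realType) : set R :=
  [set a : R | exists G : sgraph, is_smallest_eigenvalue G a].

Definition lambda_star (R : realType) (rho : R) : R :=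
  rho `^ 2^-1 + rho `^ (- 2^-1).

(* Main.v *)
(** The smallest eigenvalue of a graph exceeds [- l] iff [A + l] is positive
definite.  Write [l = t + 1/t] with [t > 1], and let [s ^ 2 = rho], so that
[lambda_star = s + 1/s = s ^ 5].

Every [l >= lambda_star] is a limit point.  Eliminating a subgraph attached to a
vertex [r] lowers the diagonal entry [l] of [r] by some [k].  These weights
[k] are stable under sums (disjoint unions), under [k |-> 1 / (l - k)] (adding a
vertex) and under addition of the odds [k / (1 - k)] (joining the attaching
sets), and the contracting iterated function systems built from these operations
show that [l] itself is a limit of weights; a cone over such a gadget has its
smallest eigenvalue close to [- l].

No [l] in ]2, lambda_star[ is one: only finitely many connected graphs have
[A + l] positive semidefinite but not [A + 2].  In a large connected graph every
small induced subgraph [F] sees a long path or a large clique through some vertex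
[p], which weighs at least [1/s] on the neighbours of [p] in [F].  A finite
computation shows that positivity then excludes a short list of configurations
on at most six vertices (the extremal case is the tree E6, where equality holds
exactly at [lambda_star]).  A graph avoiding them is, once false twins are merged,
covered by cliques in the way of a line graph, and [A + 2] is a sum of squares. *)
Require Import Defs.
From mathcomp Require Import all_boot all_order all_algebra.
From mathcomp Require Import ssrZ ring lra zify.
From mathcomp Require Import reals.

Set Implicit Arguments.
Unset Strict Implicit.
Unset Printing Implicit Defensive.

Import Order.TTheory GRing.Theory Num.Theory.
Local Open Scope ring_scope.

(** * Quadratic forms of graphs *)

(** One tree governs both directions: a vertex with arms of lengths 1, 2 and infinity. For
    [l = t + 1/t] the infinite arm weighs [1/t] and the finite ones [1/l] and [1/(l - 1/l)]; the
    three sum to at most [l] exactly when [t^6 >= t^2 + 1], that is [t^2 >= rho]. Above the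
    threshold the infinite arm can be exchanged for a gadget of adjustable weight, which brings the
    total to [l]. Below it the tree is too heavy, already with finite arms.

    The value [1/s] serves all [l < lambda_star] at once: [1/s <= 1/(l - 1/s)] holds as soon as
    [l <= s + 1/s], so eliminating the vertices of a path one by one never drops a weight below
    [1/s]. The excluded configurations therefore do not depend on [l], and since forms are monotone
    in [l] and in the weight, rational bounds settle all of them but E6, which is tight and is
    treated exactly.

    Working with quadratic forms instead of inverse matrices makes positivity pass to subgraphs and
    to larger [l] for free; eigenvalues enter only at the end. *)

Definition nbr_sum (R : realFieldType) (T : finType) (e : rel T) (x : T -> R)
    (u : T) : R :=
  \sum_v (e u v)%:R * x v.

Definition bform (R : realFieldType) (T : finType) (e : rel T) (l : R)
    (x y : T -> R) : R :=
  \sum_u x u * (l * y u + nbr_sum e y u).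

Definition qform (R : realFieldType) (T : finType) (e : rel T) (l : R)
    (x : T -> R) : R := bform e l x x.

Definition psd (R : realFieldType) (T : finType) (e : rel T) (l : R) : Prop :=
  forall x : T -> R, 0 <= qform e l x.

Definition delta (R : realFieldType) (T : finType) (u : T) : T -> R :=
  fun v => (v == u)%:R.

Section Forms.
Context {R : realFieldType} {T : finType}.
Implicit Types (e : rel T) (x y z : T -> R) (l a b : R).

Lemma nbr_sum_lin e a b x y u :
  nbr_sum e (fun v => a * x v + b * y v) u = a * nbr_sum e x u + b * nbr_sum e y u.
Proof.
rewrite /nbr_sum !big_distrr /= -big_split /=; apply: eq_bigr => v _; ring.
Qed.

Lemma bform_linr e l a b x y z :
  bform e l z (fun v => a * x v + b * y v) = a * bform e l z x + b * bform e l z y.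
Proof.
rewrite /bform !big_distrr /= -big_split /=; apply: eq_bigr => v _.
rewrite nbr_sum_lin; ring.
Qed.

Lemma bformC e l x y : symmetric e -> bform e l x y = bform e l y x.
Proof.
move=> es; rewrite /bform /nbr_sum.
under eq_bigr do rewrite mulrDr big_distrr /=.
under [RHS]eq_bigr do rewrite mulrDr big_distrr /=.
rewrite !big_split /=; congr (_ + _); first by apply: eq_bigr => u _; ring.
rewrite exchange_big /=; apply: eq_bigr => u _; apply: eq_bigr => v _.
by rewrite es; ring.
Qed.

Lemma qform_lin e l a b x y : symmetric e ->
  qform e l (fun v => a * x v + b * y v) =
  a ^+ 2 * qform e l x + 2 * a * b * bform e l x y + b ^+ 2 * qform e l y.
Proof.
move=> es; pose z v := a * x v + b * y v.
rewrite /qform -/z bform_linr (bformC l z x es) (bformC l z y es) !bform_linr.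
by rewrite (bformC l y x es); ring.
Qed.

Lemma eq_qform e l x y : x =1 y -> qform e l x = qform e l y.
Proof.
move=> xy; apply: eq_bigr => u _; rewrite xy; congr (_ * (_ + _)).
by apply: eq_bigr => v _; rewrite xy.
Qed.

Lemma qformZ e l a x : qform e l (fun v => a * x v) = a ^+ 2 * qform e l x.
Proof.
rewrite /qform /bform big_distrr /=; apply: eq_bigr => u _.
have -> : nbr_sum e (fun v => a * x v) u = a * nbr_sum e x u.
  by rewrite /nbr_sum big_distrr /=; apply: eq_bigr => v _; ring.
ring.
Qed.

Lemma qform_shift e l a x :
  qform e (l + a) x = qform e l x + a * \sum_u x u ^+ 2.
Proof.
rewrite /qform /bform big_distrr /= -big_split /=; apply: eq_bigr => u _; ring.
Qed.

Lemma qform_le e l a x : l <= a -> qform e l x <= qform e a x.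
Proof.
move=> la; rewrite -(subrKC l a) qform_shift lerDl mulr_ge0 ?subr_ge0 //.
by apply: sumr_ge0 => u _; apply: sqr_ge0.
Qed.

Lemma sum_sqr_gt0 x u : x u != 0 -> 0 < \sum_v x v ^+ 2.
Proof.
move=> xu; rewrite (bigD1 u) //= ltr_pwDl //; first by rewrite exprn_even_gt0.
by apply: sumr_ge0 => v _; apply: sqr_ge0.
Qed.

Lemma qform_lt e l a x u : x u != 0 -> l < a -> qform e l x < qform e a x.
Proof.
move=> xu la; rewrite -(subrKC l a) qform_shift ltrDl mulr_gt0 ?subr_gt0 //.
exact: sum_sqr_gt0 xu.
Qed.

Lemma psd_le e l a : l <= a -> psd e l -> psd e a.
Proof. by move=> la lP x; apply: le_trans (lP x) (qform_le e x la). Qed.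

Lemma sum_delta u (f : T -> R) : \sum_v delta R u v * f v = f u.
Proof.
rewrite (bigD1 u) //= /delta eqxx mul1r big1 ?addr0 // => v /negPf->.
by rewrite mul0r.
Qed.

Lemma bform_delta e l u y : bform e l (delta R u) y = l * y u + nbr_sum e y u.
Proof. exact: sum_delta. Qed.

Lemma nbr_sum_delta e u v : nbr_sum e (delta R u) v = (e v u)%:R.
Proof.
rewrite /nbr_sum -(sum_delta u (fun w => (e v w)%:R)).
by apply: eq_bigr => w _; rewrite mulrC.
Qed.

Lemma qform_delta e l u : irreflexive e -> qform e l (delta R u) = l.
Proof.
by move=> ei; rewrite /qform bform_delta nbr_sum_delta ei /delta eqxx mulr1 addr0.
Qed.

End Forms.

(** * Gadgets and their weights *)

Definition glue (T1 T2 : finType) (e1 : rel T1) (e2 : rel T2) (b : bool)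
    (U1 : pred T1) (U2 : pred T2) : rel (T1 + T2)%type :=
  fun u v => match u, v with
  | inl u, inl v => e1 u v
  | inr u, inr v => e2 u v
  | inl u, inr v => [&& b, U1 u & U2 v]
  | inr u, inl v => [&& b, U1 v & U2 u]
  end.

Definition glue_pred (T1 T2 : finType) (c : bool) (U1 : pred T1) (U2 : pred T2) :
    pred (T1 + T2)%type :=
  fun u => match u with inl u => U1 u | inr u => c && U2 u end.

Definition glue_fun (R : Type) (T1 T2 : Type) (x1 : T1 -> R) (x2 : T2 -> R) :
    (T1 + T2)%type -> R :=
  fun u => match u with inl u => x1 u | inr u => x2 u end.

(* [k = 1_U^T (A + l)^-1 1_U], stated without inverting the matrix. *)
Definition gadget (R : realFieldType) (l k : R) : Prop :=
  exists (T : finType) (e : rel T) (U : pred T),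
    [/\ symmetric e, irreflexive e,
        forall x : T -> R, (\sum_(u | U u) x u) ^+ 2 <= k * qform e l x &
        exists x : T -> R, \sum_(u | U u) x u = k /\ qform e l x = k].

Section Glue.
Context {R : realFieldType}.
Implicit Types (l k : R).

Lemma glue_sym (T1 T2 : finType) (e1 : rel T1) (e2 : rel T2) b U1 U2 :
  symmetric e1 -> symmetric e2 -> symmetric (glue e1 e2 b U1 U2).
Proof. by move=> s1 s2 [u|u] [v|v] /=. Qed.

Lemma glue_irr (T1 T2 : finType) (e1 : rel T1) (e2 : rel T2) b U1 U2 :
  irreflexive e1 -> irreflexive e2 -> irreflexive (glue e1 e2 b U1 U2).
Proof. by move=> s1 s2 [u|u] /=. Qed.

Lemma sum_glue (T1 T2 : finType) c (U1 : pred T1) (U2 : pred T2) (x : _ -> R) :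
  \sum_(u | glue_pred c U1 U2 u) x u =
  \sum_(u | U1 u) x (inl u) + c%:R * \sum_(u | U2 u) x (inr u).
Proof.
rewrite big_sumType /=; congr (_ + _); case: c; first by rewrite mul1r.
by rewrite mul0r big_pred0.
Qed.

Lemma qform_glue (T1 T2 : finType) (e1 : rel T1) (e2 : rel T2) b
    (U1 : pred T1) (U2 : pred T2) l (x : _ -> R) :
  qform (glue e1 e2 b U1 U2) l x =
  qform e1 l (fun u => x (inl u)) + qform e2 l (fun u => x (inr u)) +
  2 * b%:R * (\sum_(u | U1 u) x (inl u)) * (\sum_(u | U2 u) x (inr u)).
Proof.
rewrite /qform /bform big_sumType /=.
have H1 u : nbr_sum (glue e1 e2 b U1 U2) x (inl u) =
    nbr_sum e1 (fun u => x (inl u)) u +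
    b%:R * ((U1 u)%:R * \sum_(v | U2 v) x (inr v)).
  rewrite {1}/nbr_sum big_sumType /= [in RHS]big_mkcond /= !mulr_sumr; congr (_ + _).
  by apply: eq_bigr => v _; case: (b); case: (U1 u); case: (U2 v); rewrite /=; ring.
have H2 u : nbr_sum (glue e1 e2 b U1 U2) x (inr u) =
    nbr_sum e2 (fun u => x (inr u)) u +
    b%:R * ((U2 u)%:R * \sum_(v | U1 v) x (inl v)).
  rewrite {1}/nbr_sum big_sumType /= [in RHS]big_mkcond /= !mulr_sumr addrC; congr (_ + _).
  by apply: eq_bigr => v _; case: (b); case: (U2 u); case: (U1 v); rewrite /=; ring.
under eq_bigr => u _ do rewrite H1 addrA mulrDr.
under [X in _ + X = _]eq_bigr => u _ do rewrite H2 addrA mulrDr.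
rewrite !big_split /=.
set S1 := \sum_(u | U1 u) _; set S2 := \sum_(u | U2 u) _.
have -> : \sum_i x (inl i) * (b%:R * ((U1 i)%:R * S2)) = b%:R * S1 * S2.
  clearbody S2; rewrite /S1 [in RHS]big_mkcond /= mulr_sumr mulr_suml.
  by apply: eq_bigr => v _; case: (U1 v) => /=; ring.
have -> : \sum_i x (inr i) * (b%:R * ((U2 i)%:R * S1)) = b%:R * S1 * S2.
  clearbody S1; rewrite /S2 [in RHS]big_mkcond /= mulr_sumr.
  by apply: eq_bigr => v _; case: (U2 v) => /=; ring.
ring.
Qed.

Lemma qform_unit l (x : unit -> R) : qform (fun _ _ => false) l x = l * x tt ^+ 2.
Proof.
rewrite /qform /bform (bigD1 tt) //= big1 ?addr0; last by case.
by rewrite /nbr_sum big1 ?addr0 => [|[] _]; rewrite ?mul0r //; ring.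
Qed.

Lemma sum_unit (P : pred unit) (x : unit -> R) :
  P tt -> \sum_(u | P u) x u = x tt.
Proof. by move=> P1; rewrite (bigD1 tt) //= big1 ?addr0 //; case=> /andP[]. Qed.

Lemma gadget_leaf l : 0 < l -> gadget l l^-1.
Proof.
move=> l0; exists unit, (fun _ _ => false), xpredT; split=> //.
  by move=> x; rewrite qform_unit sum_unit // mulrA mulVf ?mul1r // gt_eqF.
exists (fun=> l^-1); rewrite qform_unit sum_unit //; split=> //.
by rewrite expr2 mulrA mulfV ?mul1r // gt_eqF.
Qed.

(** Weighted Cauchy-Schwarz: [(a + b)^2 / (k1 + k2) <= a^2 / k1 + b^2 / k2]. *)
Lemma gadget_add l k1 k2 : 0 < k1 -> 0 < k2 ->
  gadget l k1 -> gadget l k2 -> gadget l (k1 + k2).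
Proof.
move=> k10 k20 [T1 [e1 [U1 [s1 i1 B1 [x1 [S1 Q1]]]]]].
move=> [T2 [e2 [U2 [s2 i2 B2 [x2 [S2 Q2]]]]]].
exists (T1 + T2)%type, (glue e1 e2 false U1 U2), (glue_pred true U1 U2).
split; [exact: glue_sym | exact: glue_irr | move=> x |].
  rewrite qform_glue sum_glue mulr0 !mul0r addr0 mul1r.
  have := B1 (fun u => x (inl u)); have := B2 (fun u => x (inr u)).
  set q1 := qform e1 _ _; set q2 := qform e2 _ _.
  set a := \sum_(u | U1 u) _; set b := \sum_(u | U2 u) _ => H2 H1.
  rewrite -(ler_pM2l (mulr_gt0 k10 k20)) -subr_ge0.
  have -> : k1 * k2 * ((k1 + k2) * (q1 + q2)) - k1 * k2 * (a + b) ^+ 2 =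
    k2 * (k1 + k2) * (k1 * q1 - a ^+ 2) + k1 * (k1 + k2) * (k2 * q2 - b ^+ 2)
      + (k2 * a - k1 * b) ^+ 2 by ring.
  by rewrite !addr_ge0 ?sqr_ge0 ?mulr_ge0 ?subr_ge0 // ltW ?addr_gt0.
exists (glue_fun x1 x2); rewrite qform_glue sum_glue /= S1 S2 Q1 Q2.
by split; ring.
Qed.

(** Schur complement: with value [a] at the apex, the minimum of the form over the old gadget is
    [(l - k) a^2]. Only the apex is attached to the outside. *)
Lemma gadget_cone l k : 0 < k -> k < l -> gadget l k -> gadget l (l - k)^-1.
Proof.
move=> k0 kl [T1 [e1 [U1 [s1 i1 B1 [x1 [S1 Q1]]]]]].
have lk : 0 < l - k by rewrite subr_gt0.
exists (unit + T1)%type, (glue (fun _ _ => false) e1 true xpredT U1),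
  (glue_pred false xpredT U1).
split; [exact: glue_sym | exact: glue_irr | move=> x |].
  rewrite qform_glue sum_glue qform_unit mul0r addr0 mulr1 !sum_unit //.
  have := B1 (fun u => x (inr u)); set q := qform e1 _ _; set s := \sum_(u | U1 u) _.
  set a := x _ => H.
  rewrite -(ler_pM2l lk) mulVKf ?gt_eqF // -(ler_pM2l k0) -subr_ge0.
  have -> : k * (l * a ^+ 2 + q + 2 * a * s) - k * ((l - k) * a ^+ 2) =
    (k * q - s ^+ 2) + (s + k * a) ^+ 2 by ring.
  by rewrite addr_ge0 ?sqr_ge0 ?subr_ge0.
exists (glue_fun (fun=> (l - k)^-1) (fun u => - (l - k)^-1 * x1 u)).
rewrite qform_glue sum_glue /= qform_unit !sum_unit // -mulr_sumr S1 qformZ Q1.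
have lk0 : l - k != 0 by rewrite gt_eqF.
by split; field.
Qed.

(** Subtracting the all-ones matrix on the attaching set turns a weight [k] into its odds
    [k / (1 - k)]. After this subtraction the join is block diagonal, so the odds add like the
    weights of a disjoint union. *)
Lemma gadget_join l h1 h2 : 0 < h1 -> 0 < h2 ->
  gadget l (h1 / (1 + h1)) -> gadget l (h2 / (1 + h2)) ->
  gadget l ((h1 + h2) / (1 + (h1 + h2))).
Proof.
move=> h10 h20 [T1 [e1 [U1 [s1 i1 B1 [x1 [S1 Q1]]]]]].
move=> [T2 [e2 [U2 [s2 i2 B2 [x2 [S2 Q2]]]]]].
have p1 : 0 < 1 + h1 by rewrite addr_gt0.
have p2 : 0 < 1 + h2 by rewrite addr_gt0.
have p : 0 < 1 + (h1 + h2) by rewrite !addr_gt0.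
exists (T1 + T2)%type, (glue e1 e2 true U1 U2), (glue_pred true U1 U2).
split; [exact: glue_sym | exact: glue_irr | move=> x |].
  rewrite qform_glue sum_glue !(mulr1, mul1r).
  have := B1 (fun u => x (inl u)); have := B2 (fun u => x (inr u)).
  set q1 := qform e1 _ _; set q2 := qform e2 _ _.
  set a := \sum_(u | U1 u) _; set b := \sum_(u | U2 u) _.
  rewrite !(mulrAC _ _^-1) !ler_pdivlMr // => H2 H1.
  rewrite -(ler_pM2l (mulr_gt0 h10 h20)) -subr_ge0.
  have -> : h1 * h2 * ((h1 + h2) * (q1 + q2 + 2 * a * b)) -
      h1 * h2 * ((a + b) ^+ 2 * (1 + (h1 + h2))) =
    h2 * (h1 + h2) * (h1 * q1 - a ^+ 2 * (1 + h1)) +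
    h1 * (h1 + h2) * (h2 * q2 - b ^+ 2 * (1 + h2)) +
    (h2 * a - h1 * b) ^+ 2 by ring.
  by rewrite !addr_ge0 ?sqr_ge0 ?mulr_ge0 ?subr_ge0 // ltW ?addr_gt0.
exists (glue_fun (fun u => (1 + h1) / (1 + (h1 + h2)) * x1 u)
                 (fun u => (1 + h2) / (1 + (h1 + h2)) * x2 u)).
rewrite qform_glue sum_glue /= -!mulr_sumr S1 S2 !qformZ Q1 Q2.
have [? ? ?] : [/\ 1 + h1 != 0, 1 + h2 != 0 & 1 + (h1 + h2) != 0].
  by rewrite !gt_eqF.
by split; field; apply/and3P.
Qed.

(** The apex of the cone keeps the Schur complement [l - k], which is nearly zero; the vector with 1
    at the apex and minus the extremal vector on the gadget has exactly this value at [l]. *)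
Lemma gadget_near l k d : 0 < k -> 0 < d -> `|l - k| < d -> gadget l k ->
  exists (T : finType) (e : rel T),
    [/\ symmetric e, irreflexive e, psd e (l + d) &
        exists x : T -> R, qform e (l - d) x < 0].
Proof.
move=> k0 d0; rewrite ltr_norml => /andP[kl lk].
move=> [T1 [e1 [U1 [s1 i1 B1 [x1 [S1 Q1]]]]]].
pose e := glue (fun _ _ => false) e1 true (fun _ : unit => true) U1.
have eE (m : R) (x : unit + T1 -> R) : qform e m x = m * x (inl tt) ^+ 2 + qform e1 m (fun u => x (inr u)) +
   2 * x (inl tt) * \sum_(u | U1 u) x (inr u).
  by rewrite /e qform_glue qform_unit sum_unit // mulr1.
exists (unit + T1)%type, e; split; [exact: glue_sym | exact: glue_irr | move=> x |].
  rewrite qform_shift eE.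
  have /= : (x (inl tt)) ^+ 2 <= \sum_u x u ^+ 2.
    rewrite (bigD1 (inl tt)) //= lerDl; apply: sumr_ge0 => v _; exact: sqr_ge0.
  have := B1 (fun u => x (inr u)).
  set q := qform e1 _ _; set s := \sum_(u | U1 u) _; set a := x _; set N := \sum_u _.
  move=> H HN.
  have H2 : (l - k) * a ^+ 2 <= l * a ^+ 2 + q + 2 * a * s.
    rewrite -(ler_pM2l k0) -subr_ge0.
    have -> : k * (l * a ^+ 2 + q + 2 * a * s) - k * ((l - k) * a ^+ 2) =
      (k * q - s ^+ 2) + (s + k * a) ^+ 2 by ring.
    by rewrite addr_ge0 ?sqr_ge0 ?subr_ge0.
  have H3 : - d * a ^+ 2 <= (l - k) * a ^+ 2 by rewrite ler_wpM2r ?sqr_ge0 // ltW.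
  have H4 : d * a ^+ 2 <= d * N by rewrite ler_wpM2l // ltW.
  lra.
pose x : unit + T1 -> R := glue_fun (fun=> 1) (fun u => - x1 u).
exists x; rewrite qform_shift eE /x /= sumrN S1.
rewrite (_ : qform e1 l (fun u => - x1 u) = k); last first.
  rewrite -Q1 (eq_qform _ _ (y := fun u => (-1) * x1 u)) ?qformZ; last first.
    by move=> u; rewrite mulN1r.
  by ring.
have : 1 <= \sum_u x u ^+ 2.
  rewrite (bigD1 (inl tt)) //= expr1n lerDl; apply: sumr_ge0 => v _; exact: sqr_ge0.
rewrite -/x; set N := \sum_u _ => HN.
have : d * 1 <= d * N by rewrite ler_wpM2l // ltW.
lra.
Qed.

End Glue.

(** * Weights that are limits of gadget weights *)

(** Approximation is from below: then [l - k'] stays at least [l - k], so cones remain defined and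
    errors propagate in one direction only. *)
Definition approx (R : realFieldType) (l k : R) : Prop :=
  forall d, 0 < d -> exists k', [/\ 0 < k', k - d < k', k' <= k & gadget l k'].

Section Approx.
Context {R : realType}.
Implicit Types (l k t : R).

Lemma exists_expr_lt (q d : R) : 0 <= q -> q < 1 -> 0 < d -> exists n, q ^+ n < d.
Proof.
move=> q0 q1 d0; have [->|qn0] := eqVneq q 0; first by exists 1%N; rewrite expr1.
have qp : 0 < q by rewrite lt_def qn0.
pose c := q^-1 - 1; have c0 : 0 < c by rewrite subr_gt0 invf_gt1.
have bern n : n%:R * c <= q^-1 ^+ n.
  have -> : q^-1 = c + 1 by rewrite subrK.
  suff : 1 + n%:R * c <= (c + 1) ^+ n by lra.
  elim: n => [|n IH]; first by rewrite mul0r addr0 expr0.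
  have : (c + 1) * (1 + n%:R * c) <= (c + 1) * (c + 1) ^+ n.
    by rewrite ler_wpM2l // addr_ge0 // ltW.
  have : 0 <= n%:R * c * c by rewrite !mulr_ge0 // ltW.
  rewrite exprS -natr1; lra.
pose n := (Num.truncn (d^-1 / c)).+1; exists n.
have /andP[_ H] := truncn_itv (divr_ge0 (ltW (divr_gt0 ltr01 d0)) (ltW c0)).
rewrite mul1r ltr_pdivrMr // in H.
have := lt_le_trans H (bern n).
by rewrite exprVn ltf_pV2 // posrE exprn_gt0.
Qed.

Lemma approx_of_rate l k (q : R) : 0 <= q -> q < 1 ->
  (forall n : nat, exists k', [/\ 0 < k', k - k' <= q ^+ n, k' <= k & gadget l k']) ->
  approx l k.
Proof.
move=> q0 q1 H d d0; have [n nd] := exists_expr_lt q0 q1 d0.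
by have [k' [k0 kq kk G]] := H n; exists k'; split=> //; lra.
Qed.

Lemma approx_leaf l : 0 < l -> approx l l^-1.
Proof.
move=> l0 d d0; exists l^-1; split=> //; last exact: gadget_leaf; last lra.
by rewrite invr_gt0.
Qed.

Lemma approx_gadget l k : 0 < k -> gadget l k -> approx l k.
Proof. by move=> k0 G d d0; exists k; split=> //; lra. Qed.

Lemma approx_add l k1 k2 : approx l k1 -> approx l k2 -> approx l (k1 + k2).
Proof.
move=> H1 H2 d d0; have d2 : 0 < d / 2 by lra.
have [a [a0 ad ak Ga]] := H1 _ d2; have [b [b0 bd bk Gb]] := H2 _ d2.
by exists (a + b); split; [lra | lra | lra | exact: gadget_add].
Qed.

Lemma gadget_add_leaves l k n : 0 < l -> 0 < k -> gadget l k ->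
  gadget l (n%:R / l + k).
Proof.
move=> l0 k0 G; elim: n => [|n IH]; first by rewrite mul0r add0r.
have -> : n.+1%:R / l + k = l^-1 + (n%:R / l + k) by rewrite -natr1 mulrDl; ring.
apply: gadget_add => //; [by rewrite invr_gt0 | | exact: gadget_leaf].
by rewrite ltr_wpDl // divr_ge0 // ltW.
Qed.

Lemma gadget_join_leaves l h n : 1 < l -> 0 < h -> gadget l (h / (1 + h)) ->
  gadget l ((n%:R / (l - 1) + h) / (1 + (n%:R / (l - 1) + h))).
Proof.
move=> l1 h0 G; have l10 : 0 < l - 1 by rewrite subr_gt0.
elim: n => [|n IH]; first by rewrite mul0r add0r.
have -> : n.+1%:R / (l - 1) + h = (l - 1)^-1 + (n%:R / (l - 1) + h).
  by rewrite -natr1 mulrDl; ring.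
apply: gadget_join => //; first by rewrite invr_gt0.
  by rewrite ltr_wpDl // divr_ge0 // ltW.
have -> : (l - 1)^-1 / (1 + (l - 1)^-1) = l^-1.
  by field; rewrite !gt_eqF //=; lra.
by apply: gadget_leaf; lra.
Qed.

(* The fixed points of [k |-> 1 / (l - k)] are [t] and [1 / t]. *)
Lemma approx_tree l t : 1 < t -> l = t + t^-1 -> t^-1 + l^-1 < 1 ->
  forall k, t^-1 <= k -> approx l k.
Proof.
move=> t1 lt u1 k0 tk0; have t0 : 0 < t by lra.
have ti : 0 < t^-1 by rewrite invr_gt0.
have l0 : 0 < l by lra.
have li : 0 < l^-1 by rewrite invr_gt0.
have li1 : l^-1 < 1 by lra.
set u := t^-1 + l^-1 in u1; have u0 : 0 < u by rewrite addr_gt0.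
have [q0 q1] : 0 <= u ^+ 2 /\ u ^+ 2 < 1 by rewrite sqr_ge0 expr_lt1 // ltW.
apply: (approx_of_rate q0 q1) => n; elim: n k0 tk0 => [|n IH] k tk.
  have lt1 : l^-1 <= t^-1 by rewrite lef_pV2 // lt lerDl ltW.
  have [m mk] : exists m : nat, m%:R / l <= k - l^-1 < m.+1%:R / l.
    have /truncn_itv/andP[m1 m2] : 0 <= (k - l^-1) * l by apply: mulr_ge0; lra.
    by exists (Num.truncn ((k - l^-1) * l)); rewrite ler_pdivrMr // ltr_pdivlMr // m1.
  exists (m%:R / l + l^-1); move: mk; rewrite -natr1 mulrDl mul1r => /andP[m1 m2].
  have m0 : 0 <= m%:R / l by rewrite divr_ge0 // ltW.
  split; [lra | rewrite expr0; lra | lra |].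
  by apply: gadget_add_leaves => //; apply: gadget_leaf.
have [m mk] : exists m : nat, m%:R / l <= k - t^-1 < m.+1%:R / l.
  have /truncn_itv/andP[m1 m2] : 0 <= (k - t^-1) * l by apply: mulr_ge0; lra.
  by exists (Num.truncn ((k - t^-1) * l)); rewrite ler_pdivrMr // ltr_pdivlMr // m1.
move: mk; rewrite -natr1 mulrDl mul1r => /andP[m1 m2].
(* Removing leaves brings the weight into [[1/t, u[], where it is the weight of a cone; the preimage
   [l - 1/v] is again at least [1/t]. The cone map has slope at most [u^2 < 1] there. *)
pose v := k - m%:R / l.
have tv : t^-1 <= v by rewrite /v; lra.
have vu : v < u by rewrite /v /u; lra.
have v0 : 0 < v by lra.
have tk1 : t^-1 <= l - v^-1.
  by rewrite lerBrDr lt addrC lerD2r invf_ple // posrE.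
have [k1 [k10 k1q k1k G1]] := IH _ tk1.
have lk1 : v^-1 <= l - k1 by lra.
have lk10 : 0 < l - k1 by apply: lt_le_trans lk1; rewrite invr_gt0.
have w0 : 0 < (l - k1)^-1 by rewrite invr_gt0.
have wv : (l - k1)^-1 <= v by rewrite invf_ple // posrE.
exists (m%:R / l + (l - k1)^-1).
have m0 : 0 <= m%:R / l by rewrite divr_ge0 // ltW.
split; [lra | | rewrite /v in wv; lra |]; last first.
  apply: gadget_add_leaves => //; apply: gadget_cone => //; lra.
have -> : k - (m%:R / l + (l - k1)^-1) = v * (l - k1)^-1 * (l - v^-1 - k1).
  have -> : k - (m%:R / l + (l - k1)^-1) = v - (l - k1)^-1 by rewrite /v; ring.
  by clearbody v; field; rewrite !gt_eqF.
rewrite exprS; apply: ler_pM; [by rewrite mulr_ge0 ?ltW|lra| |done].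
by rewrite expr2; apply: ler_pM; lra.
Qed.

(** At [a = 0] the upper bound is an equality, because [h / (1 + h) = 1 / (1 + 1/h)]; a larger [a]
    only flattens [h |-> h / (1 + h)]. *)
Lemma odds_contraction (a v w : R) : 0 <= a -> 0 < w -> w <= v ->
  0 <= (a + v) / (1 + (a + v)) - (a + w) / (1 + (a + w)) <=
    (1 + v^-1)^-1 * (1 + w^-1)^-1 * (w^-1 - v^-1).
Proof.
move=> a0 w0 wv; have v0 : 0 < v by lra.
have [p1 p2 p3 p4] : [/\ 0 < 1 + (a + v), 0 < 1 + (a + w), 0 < 1 + v & 0 < 1 + w].
  by split; lra.
have -> : (a + v) / (1 + (a + v)) - (a + w) / (1 + (a + w)) =
    (v - w) * ((1 + (a + v))^-1 * (1 + (a + w))^-1).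
  by field; rewrite !gt_eqF.
have -> : (1 + v^-1)^-1 * (1 + w^-1)^-1 * (w^-1 - v^-1) =
    (v - w) * ((1 + v)^-1 * (1 + w)^-1).
  by field; rewrite !gt_eqF //; lra.
apply/andP; split.
  by apply: mulr_ge0; [lra | rewrite mulr_ge0 // invr_ge0 ltW].
rewrite ler_wpM2l ?subr_ge0 //.
by apply: ler_pM; rewrite ?invr_ge0 ?(ltW p1) ?(ltW p2) ?lef_pV2 ?posrE //; lra.
Qed.

(* The odds of [k] are [m / (l - 1)], from [m] leaves, plus the odds
   [v = 1 / (l - 1 - k1)] of a cone of weight [1 / (l - k1)]; solving for [k1]
   contracts distances by the factor [1 / (l - 1) ^ 2]. *)
Lemma approx_window l t : 1 < t -> l = t + t^-1 ->
  (t - 1)^-1 + (l - 1)^-1 <= (l - 2)^-1 ->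
  forall k, t^-1 <= k -> k < 1 -> approx l k.
Proof.
move=> t1 lt cov k0 tk0 k01; have t0 : 0 < t by lra.
have ti : 0 < t^-1 by rewrite invr_gt0.
have l2 : 2 < l.
  rewrite -subr_gt0; have -> : l - 2 = (t - 1) ^+ 2 / t by rewrite lt; field; rewrite gt_eqF.
  by rewrite divr_gt0 // exprn_gt0 // subr_gt0.
have l0 : 0 < l by lra.
have l10 : 0 < l - 1 by lra.
have a0 : 0 < (t - 1)^-1 by rewrite invr_gt0; lra.
have b0 : 0 < (l - 1)^-1 by rewrite invr_gt0.
have [q0 q1] : 0 <= (l - 1)^-1 ^+ 2 /\ (l - 1)^-1 ^+ 2 < 1.
  split; first exact: sqr_ge0.
  by rewrite expr_lt1 // ?ltW // invf_lt1 //; lra.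
apply: (approx_of_rate q0 q1) => n; elim: n k0 tk0 k01 => [|n IH] k tk k1.
  have lt1 : l^-1 <= t^-1 by rewrite lef_pV2 // lt lerDl ltW.
  have li : 0 < l^-1 by rewrite invr_gt0.
  exists l^-1; split=> //; [rewrite expr0; lra | lra | exact: gadget_leaf].
pose H := k / (1 - k).
have k_0 : 0 < k by lra.
(* [1 / (t - 1)] is the odds of the weight [1/t]. *)
have tH : (t - 1)^-1 <= H.
  by rewrite /H ler_pdivlMr ?subr_gt0 // mulrC ler_pdivrMr ?subr_gt0 //;
     move: tk; rewrite -[t^-1]div1r ler_pdivrMr //; lra.
have [m mk] : exists m : nat, m%:R / (l - 1) <= H - (t - 1)^-1 < m.+1%:R / (l - 1).
  have /truncn_itv/andP[m1 m2] : 0 <= (H - (t - 1)^-1) * (l - 1).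
    by apply: mulr_ge0; lra.
  by exists (Num.truncn ((H - (t - 1)^-1) * (l - 1))); rewrite ler_pdivrMr // ltr_pdivlMr // m1.
move: mk; rewrite -natr1 mulrDl mul1r => /andP[m1 m2].
have m0 : 0 <= m%:R / (l - 1) by rewrite divr_ge0 // ltW.
have kE : k = H / (1 + H) by rewrite /H; field; rewrite subrK oner_eq0 gt_eqF ?subr_gt0.
have [v vE] : exists v, H = m%:R / (l - 1) + v.
  by exists (H - m%:R / (l - 1)); rewrite subrKC.
move: (m%:R / (l - 1)) m0 vE m1 m2 (fun h => @gadget_join_leaves l h m) => b bn0 vE m1 m2 Gj.
clearbody H; have tv : (t - 1)^-1 <= v by lra.
have v0 : 0 < v by lra.
have tk1 : t^-1 <= l - 1 - v^-1.
  have : v^-1 <= t - 1 by rewrite invf_ple // posrE subr_gt0.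
  by rewrite lt; lra.
(* The role of [cov]: the odds left after removing leaves stay below [1 / (l - 2)], so that the
   weight to be approximated next lies in the window [[1/t, 1[] again. *)
have k11 : l - 1 - v^-1 < 1.
  have vl : v < (l - 2)^-1 by lra.
  have : l - 2 < v^-1 by rewrite -(invrK (l - 2)) ltf_pV2 // posrE ?invr_gt0 ?subr_gt0.
  lra.
have [c [c0 cq ck G]] := IH _ tk1 k11.
have vi0 : 0 < v^-1 by rewrite invr_gt0.
have lc0 : 0 < l - 1 - c by lra.
have [w wE] : exists w, w^-1 = l - 1 - c by exists (l - 1 - c)^-1; rewrite invrK.
have w0 : 0 < w by rewrite -invr_gt0 wE.
have wv : w <= v by rewrite -lef_pV2 ?posrE // wE; lra.
have /andP[H1 H2] := odds_contraction bn0 w0 wv.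
rewrite -vE -kE in H1 H2.
exists ((b + w) / (1 + (b + w))); split.
- by rewrite divr_gt0 //; lra.
- apply: le_trans H2 _; rewrite exprS wE.
  have -> : l - 1 - c - v^-1 = l - 1 - v^-1 - c by ring.
  have l1v : 0 < 1 + v^-1 by lra.
  have l1c : 0 < 1 + (l - 1 - c) by lra.
  apply: ler_pM; rewrite ?mulr_ge0 ?invr_ge0 ?(ltW l1v) ?(ltW l1c) ?subr_ge0 //.
  by rewrite expr2; apply: ler_pM; rewrite ?invr_ge0 ?(ltW l1v) ?(ltW l1c) ?lef_pV2 ?posrE //; lra.
- by rewrite -subr_ge0.
apply: Gj => //; first lra.
have -> : w / (1 + w) = (l - c)^-1.
  have -> : l - c = w^-1 + 1 by rewrite wE; ring.
  by field; rewrite !gt_eqF //; lra.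
by apply: gadget_cone => //; lra.
Qed.

End Approx.

(** * Every [l] from the threshold on is approximable *)

Section Reach.
Context {R : realType}.
Implicit Types (l k t s : R).

Lemma exists_param l : 2 < l -> exists2 t, 1 < t & l = t + t^-1.
Proof.
move=> l2; have d0 : 0 <= l ^+ 2 - 4 by nra.
pose t := (l + Num.sqrt (l ^+ 2 - 4)) / 2.
have tE : 2 * t - l = Num.sqrt (l ^+ 2 - 4) by rewrite /t; field.
have s0 := sqrtr_ge0 (l ^+ 2 - 4).
have t1 : 1 < t by lra.
exists t => //; have := sqr_sqrtr d0; rewrite -tE => H.
have t0 : t != 0 by rewrite gt_eqF //; lra.
by apply: (mulfI t0); rewrite mulrDr mulfV //; nra.
Qed.

Lemma param_le s t : 1 < s -> 1 < t -> s + s^-1 <= t + t^-1 -> s <= t.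
Proof.
move=> s1 t1; rewrite -subr_ge0 !leNgt; apply: contra => ts.
have -> : t + t^-1 - (s + s^-1) = - ((s - t) * (1 - t^-1 * s^-1)).
  by field; rewrite !gt_eqF //; lra.
rewrite oppr_lt0 mulr_gt0 ?subr_gt0 //.
have : t^-1 < 1 by rewrite invf_lt1 //; lra.
have : s^-1 < 1 by rewrite invf_lt1 //; lra.
have : 0 < t^-1 by rewrite invr_gt0; lra.
have : 0 < s^-1 by rewrite invr_gt0; lra.
nra.
Qed.

(** The covering condition holds up to about 2.755, while the contraction of [approx_tree] starts at
    about 2.325; [12 / 5] is a convenient value in between. *)
Lemma window_cover l t : 1 < t -> l = t + t^-1 -> l <= 12 / 5 ->
  (t - 1)^-1 + (l - 1)^-1 <= (l - 2)^-1.
Proof.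
move=> t1 lt l24; have t0 : 0 < t by lra.
have ht : t ^+ 2 + 1 <= 12 / 5 * t.
  have -> : t ^+ 2 + 1 = l * t by rewrite lt; field; rewrite gt_eqF.
  by rewrite ler_pM2r.
have -> : l - 2 = (t - 1) ^+ 2 / t by rewrite lt; field; rewrite gt_eqF.
have -> : l - 1 = (t ^+ 2 - t + 1) / t by rewrite lt; field; rewrite gt_eqF.
have p : 0 < t ^+ 2 - t + 1 by nra.
rewrite -subr_ge0.
have -> : ((t - 1) ^+ 2 / t)^-1 - ((t - 1)^-1 + ((t ^+ 2 - t + 1) / t)^-1) =
   (t ^+ 2 - t + 1 - t * (t - 1) ^+ 2) / ((t - 1) ^+ 2 * (t ^+ 2 - t + 1)).
  by field; rewrite !gt_eqF //; lra.
have : 0 < (t - 1) ^+ 2 by rewrite exprn_gt0 //; lra.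
by move=> ?; rewrite divr_ge0 ?mulr_ge0 ?ltW //; nra.
Qed.

(** For small [l], the total [l] splits into a leaf, a path on two vertices and a rest in the
    window; that the rest is at least [1/t] is the inequality [t^6 >= t^2 + 1]. For medium [l] it
    splits into a leaf and two equal weights in the window, and for large [l] the tree construction
    reaches [l] directly. *)
Lemma approx_self s l : 1 < s -> s ^+ 6 = s ^+ 2 + 1 -> s + s^-1 <= l -> approx l l.
Proof.
move=> s1 s6 sl; have s0 : 0 < s by lra.
have l2 : 2 < l.
  apply: lt_le_trans sl; rewrite -subr_gt0.
  have -> : s + s^-1 - 2 = (s - 1) ^+ 2 / s by field; rewrite gt_eqF.
  by rewrite divr_gt0 // exprn_gt0 // subr_gt0.
have [t t1 lt] := exists_param l2.
have st : s <= t by apply: param_le; rewrite // -lt.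
have t0 : 0 < t by lra.
have ty : t ^+ 6 >= t ^+ 2 + 1.
  have y1 : s ^+ 2 <= t ^+ 2 by rewrite ler_pXn2r // nnegrE; lra.
  have y2 : 1 < s ^+ 2 by rewrite expr2; nra.
  move: s6; have e6 (x : R) : x ^+ 6 = (x ^+ 2) ^+ 3 by rewrite -exprM.
  rewrite !e6; move: (s ^+ 2) (t ^+ 2) y1 y2 => a b ab a1 a3.
  have : 0 <= (b - a) * (b ^+ 2 + a * b + a ^+ 2 - 1) by rewrite mulr_ge0; nra.
  lra.
have y2 : 1 < t ^+ 2 by rewrite expr2; nra.
have e4 : t ^+ 4 = (t ^+ 2) ^+ 2 by rewrite -exprM.
have p1 : 0 < t ^+ 2 + 1 by lra.
have l0 : 0 < l by lra.
have li : 0 < l^-1 by rewrite invr_gt0.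
have ll : l^-1 < 1 by rewrite invf_lt1 //; lra.
have lE : l^-1 = t / (t ^+ 2 + 1) by rewrite lt; field; rewrite !gt_eqF //; lra.
have tl : t * l = t ^+ 2 + 1 by rewrite lt; field; rewrite gt_eqF.
have m0 : 0 < l - l^-1 by lra.
case: (lerP l (12 / 5)) => [l24|l24]; last first.
  apply: (approx_tree t1 lt); last by rewrite lt; lra.
  rewrite lE -subr_gt0.
  have -> : 1 - (t^-1 + t / (t ^+ 2 + 1)) = (t ^+ 3 - 2 * t ^+ 2 + t - 1) / (t * (t ^+ 2 + 1)).
    by field; rewrite !gt_eqF //; lra.
  have t18 : 9 / 5 < t by nra.
  by rewrite divr_gt0 ?mulr_gt0 //; nra.
have win := approx_window t1 lt (window_cover t1 lt l24).
have leaf := approx_leaf l0.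
(* The first splitting keeps its rest below 1 up to about 2.095; the second has its halves above
   [1/t] from about 2.058 on. *)
case: (lerP l (208 / 100)) => [l208|l208].
  have cone : approx l (l - l^-1)^-1.
    apply: approx_gadget; first by rewrite invr_gt0.
    by apply: gadget_cone; [|lra|exact: gadget_leaf].
  have lc : l - l^-1 = (t ^+ 4 + t ^+ 2 + 1) / (t * (t ^+ 2 + 1)).
    by rewrite lt; field; rewrite !gt_eqF.
  have q0 : 0 < t ^+ 4 + t ^+ 2 + 1 by rewrite e4; nra.
  suff : approx l (l^-1 + ((l - l^-1)^-1 + (l - l^-1 - (l - l^-1)^-1))).
    by have -> : l^-1 + ((l - l^-1)^-1 + (l - l^-1 - (l - l^-1)^-1)) = l by ring.
  apply: approx_add => //; apply: approx_add => //; apply: win.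
    rewrite lc -subr_ge0; have -> :
      (t ^+ 4 + t ^+ 2 + 1) / (t * (t ^+ 2 + 1)) -
      ((t ^+ 4 + t ^+ 2 + 1) / (t * (t ^+ 2 + 1)))^-1 - t^-1 =
      t * (t ^+ 6 - t ^+ 2 - 1) / ((t ^+ 4 + t ^+ 2 + 1) * (t ^+ 2 + 1)).
      by field; rewrite !gt_eqF.
    by rewrite divr_ge0 ?mulr_ge0 ?(ltW p1) ?(ltW q0) ?(ltW t0) //; lra.
  have c1 : l - l^-1 <= 8 / 5.
    suff : 12 / 25 <= l^-1 by lra.
    by rewrite -[l^-1]mul1r ler_pdivlMr //; lra.
  have : (8 / 5)^-1 <= (l - l^-1)^-1 by rewrite lef_pV2 // posrE; lra.
  lra.
suff : approx l (l^-1 + ((l - l^-1) / 2 + (l - l^-1) / 2)).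
  by have -> : l^-1 + ((l - l^-1) / 2 + (l - l^-1) / 2) = l by field; rewrite gt_eqF.
have half : approx l ((l - l^-1) / 2).
  apply: win; last first.
    suff : 41 / 100 <= l^-1 by lra.
    by rewrite -[l^-1]mul1r ler_pdivlMr //; lra.
  have y3 : 0 <= t ^+ 4 - t ^+ 2 - 1.
    have tl2 : 208 / 100 * t <= t ^+ 2 + 1 by rewrite -tl mulrC ler_wpM2l; lra.
    have : (208 / 100) ^+ 2 * t ^+ 2 <= (t ^+ 2 + 1) ^+ 2.
      by rewrite -exprMn; apply: lerXn2r => //; rewrite nnegrE; lra.
    rewrite e4; move: (t ^+ 2) y2 => y y2 H; nra.
  rewrite -subr_ge0; have -> :
    (l - l^-1) / 2 - t^-1 = (t ^+ 4 - t ^+ 2 - 1) / (2 * t * (t ^+ 2 + 1)).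
    by rewrite lt; field; rewrite !gt_eqF.
  by rewrite divr_ge0 ?mulr_ge0 ?(ltW p1) ?(ltW t0).
by apply: approx_add => //; apply: approx_add.
Qed.

End Reach.

(** * Large connected graphs *)

Definition connected_rel (T : finType) (e : rel T) : Prop :=
  forall D : {set T}, D != set0 ->
    (forall u v, u \in D -> e u v -> v \in D) -> D = setT.

Definition clique (T : finType) (e : rel T) (Q : {set T}) : Prop :=
  {in Q &, forall u v, u != v -> e u v}.

Lemma ramsey (T : finType) (e : rel T) (s t : nat) (A : {set T}) :
  symmetric e -> irreflexive e -> (2 ^ (s + t) <= #|A|)%N ->
  (exists Q : {set T}, [/\ Q \subset A, #|Q| = s & clique e Q]) \/
  (exists I : {set T}, [/\ I \subset A, #|I| = t & {in I &, forall u v, ~~ e u v}]).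
Proof.
move=> es ei; move: {2}(s + t)%N (leqnn (s + t)) => m.
elim: m s t A => [|m IH] [|s] [|t] A //.
- by left; exists set0; rewrite sub0set cards0; split=> // u; rewrite inE.
- by left; exists set0; rewrite sub0set cards0; split=> // u; rewrite inE.
- by left; exists set0; rewrite sub0set cards0; split=> // u; rewrite inE.
- by right; exists set0; rewrite sub0set cards0; split=> // u; rewrite inE.
move=> stm cA; have /set0Pn[v vA] : A != set0 by rewrite -cards_eq0; lia.
pose A1 := [set u in A | e v u]; pose A2 := [set u in A | (u != v) && ~~ e v u].
have c12 : (#|A1| + #|A2| + 1)%N = #|A|.
  rewrite (cardsD1 v A) vA addnC; congr (_ + _)%N.
  rewrite -(cardsID [set u | e v u] (A :\ v)); congr (_ + _)%N; apply: eq_card => u.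
    by rewrite !inE; case: eqVneq => [->|]; rewrite ?ei ?andbF //= andbC.
  by rewrite !inE; case: (u != v); case: (u \in A); case: (e v u).
have [c1|c1] := leqP (2 ^ (s + t.+1)) #|A1|.
  case: (IH s t.+1 A1) => [||[Q [QA cQ kQ]]|[I [IA cI kI]]]; try lia.
    left; exists (v |: Q); split.
    - rewrite subUset sub1set vA; apply: subset_trans QA _.
      by apply/subsetP => u; rewrite inE => /andP[].
    - rewrite cardsU1 cQ; suff -> : v \notin Q by [].
      by apply/negP => /(subsetP QA); rewrite inE ei andbF.
    - have vQ u : u \in Q -> e v u by move=> /(subsetP QA); rewrite inE => /andP[].
      move=> a b /setU1P[->|aQ] /setU1P[->|bQ]; rewrite ?eqxx //.
      + by move=> _; apply: vQ.
      + by move=> _; rewrite es; apply: vQ.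
      + exact: kQ.
  right; exists I; split=> //; apply: subset_trans IA _.
  by apply/subsetP => u; rewrite inE => /andP[].
have c2 : (2 ^ (s.+1 + t) <= #|A2|)%N.
  have E : (s + t.+1 = s.+1 + t)%N by lia.
  by rewrite -E; move: cA; rewrite addSn expnS; lia.
case: (IH s.+1 t A2) => [||[Q [QA cQ kQ]]|[I [IA cI kI]]]; try lia.
  left; exists Q; split=> //; apply: subset_trans QA _.
  by apply/subsetP => u; rewrite inE => /andP[].
right; exists (v |: I); split.
- rewrite subUset sub1set vA; apply: subset_trans IA _.
  by apply/subsetP => u; rewrite inE => /andP[].
- rewrite cardsU1 cI; suff -> : v \notin I by [].
  by apply/negP => /(subsetP IA); rewrite inE eqxx andbF.
have vI u : u \in I -> ~~ e v u by move=> /(subsetP IA); rewrite inE => /and3P[].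
move=> a b /setU1P[->|aI] /setU1P[->|bI]; rewrite ?ei //.
- exact: vI.
- by rewrite es; apply: vI.
- exact: kI.
Qed.

Lemma pigeonhole_fiber (T I : finType) (f : T -> I) (A : {set T}) (m : nat) :
  (#|I| * m < #|A|)%N -> exists i, (m < #|[set u in A | f u == i]|)%N.
Proof.
move=> cA; apply/existsP; apply: contraLR cA; rewrite negb_exists => /forallP H.
rewrite -leqNgt -sum1_card (partition_big f predT) //= -sum_nat_const.
apply: leq_sum => i _; rewrite sum1_card leqNgt.
by apply: contra (H i); rewrite (@eq_card _ _ [set u in A | f u == i]) // => u; rewrite !inE.
Qed.

(** * Distance layers and elimination of tails *)

Section Ball.
Context {T : finType} (e : rel T) (F : {set T}).

Definition gball (j : nat) : {set T} :=
  iter j (fun D => D :|: [set v | [exists u in D, e u v]]) F.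

Lemma gballS j v : (v \in gball j.+1) = (v \in gball j) || [exists u in gball j, e u v].
Proof. by rewrite /gball iterS !inE. Qed.

Lemma gball_step j u v : u \in gball j -> e u v -> v \in gball j.+1.
Proof.
by move=> uB uv; rewrite gballS; apply/orP; right; apply/existsP; exists u; rewrite uB.
Qed.

Lemma gball_pred j v : v \in gball j.+1 -> v \notin gball j -> exists2 u, u \in gball j & e u v.
Proof. by rewrite gballS => /orP[->//|/existsP[u /andP[]]]; exists u. Qed.

Lemma gball_mono i j : (i <= j)%N -> gball i \subset gball j.
Proof.
move=> ij; rewrite -(subnK ij); elim: (j - i)%N => [|n IH] //.
by rewrite addSn; apply: subset_trans IH _; apply/subsetP => v vB; rewrite gballS vB.
Qed.

Lemma card_gball (d j : nat) : (forall u, #|[set v | e u v]| < d)%N ->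
  (#|gball j| <= #|F| * d ^ j)%N.
Proof.
move=> deg; elim: j => [|j IH]; first by rewrite muln1.
rewrite expnSr mulnA; apply: leq_trans (_ : #|gball j| * d <= _)%N; last by rewrite leq_mul2r IH orbT.
rewrite /gball iterS -/(gball j); move: (gball j) => D.
apply: leq_trans (_ : #|\bigcup_(u in D) (u |: [set v | e u v])| <= _)%N.
  apply: subset_leq_card; apply/subsetP => v; rewrite !inE => /orP[vD|/existsP[u /andP[uD uv]]].
    by apply/bigcupP; exists v => //; rewrite !inE eqxx.
  by apply/bigcupP; exists u => //; rewrite !inE uv orbT.
rewrite -sum_nat_const; elim/big_rec2: _ => [|u m S _ IHm]; first by rewrite cards0.
apply: leq_trans (leq_card_setU _ _) _; rewrite leq_add // cardsU1.
by apply: leq_trans (deg u); rewrite -add1n leq_add2r leq_b1.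
Qed.

End Ball.

(* [y] is a vector outside [D] which, seen from [D], acts as one extra vertex
   attached to [K] whose elimination adds [- k (sum_K x)^2] to the form. *)
Definition tail (R : realFieldType) (T : finType) (e : rel T) (l : R) (D : {set T})
    (K : pred T) (k : R) : Prop :=
  exists y : T -> R, [/\ {in D, forall u, y u = 0},
    {in D, forall u, nbr_sum e y u = k * (K u)%:R} & qform e l y = k].

Section Tail.
Context {R : realFieldType} {T : finType} (e : rel T) (l : R)
  (es : symmetric e) (ei : irreflexive e).

Lemma tail_sub (D D' : {set T}) (K K' : pred T) k :
  D' \subset D -> {in D', K =1 K'} -> tail e l D K k -> tail e l D' K' k.
Proof.
move=> /subsetP DD KK [y [y0 yK yq]]; exists y; split=> // u uD; first exact/y0/DD.
by rewrite yK ?KK //; apply: DD.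
Qed.

Lemma tail0 (D : {set T}) K : tail e l D K 0.
Proof.
exists (fun=> 0); split=> // [u _|].
  by rewrite mul0r /nbr_sum big1 // => v _; rewrite mulr0.
by rewrite /qform /bform big1 // => v _; rewrite mul0r.
Qed.

Lemma tail_cone (D : {set T}) p k : p \in D -> k < l ->
  tail e l D (pred1 p) k -> tail e l (D :\ p) (e p) (l - k)^-1.
Proof.
move=> pD kl [y [y0 yK yq]]; set k' := (l - k)^-1.
have lk : l - k != 0 by rewrite gt_eqF // subr_gt0.
(* [delta p - y] has form [l - 2k + k = l - k] and is seen from the rest exactly as [p] is; the
   factor [k'] makes form and coupling agree. *)
exists (fun v => k' * delta R p v + (- k') * y v); split=> [u|u|].
- by rewrite !inE => /andP[up uD]; rewrite y0 // /delta (negPf up) /=; ring.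
- rewrite !inE => /andP[up uD]; rewrite nbr_sum_lin nbr_sum_delta yK //= (negPf up) es /=.
  by ring.
rewrite qform_lin // qform_delta // bform_delta yq y0 // yK //= eqxx /k' /=.
by field.
Qed.

(** A constant vector on [Q] suffices, since all of [Q] looks alike from [D]. The weight tends to 1
    as the clique grows, beyond that of any path. *)
Lemma tail_clique (D Q : {set T}) K : clique e Q -> [disjoint D & Q] -> Q != set0 ->
  0 < l -> {in D & Q, forall u v, e u v = K u} ->
  tail e l D K (#|Q|%:R / (l - 1 + #|Q|%:R)).
Proof.
move=> kQ DQ Q0 l0 DK; set m := #|Q|%:R : R.
have m1 : 1 <= m by rewrite ler1n card_gt0.
have lm : l - 1 + m != 0 by rewrite gt_eqF //; lra.
have sumQ (P : T -> bool) : \sum_v (P v)%:R * ((l - 1 + m)^-1 * (v \in Q)%:R) =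
    (l - 1 + m)^-1 * \sum_(v in Q) (P v)%:R.
  rewrite [in RHS]big_mkcond mulr_sumr; apply: eq_bigr => v _.
  by case: (v \in Q) => /=; ring.
exists (fun v => (l - 1 + m)^-1 * (v \in Q)%:R); split=> [u uD|u uD|].
- by rewrite (disjointFr DQ) // mulr0.
- rewrite /nbr_sum sumQ (eq_bigr (fun=> (K u)%:R)) => [|v vQ]; last by rewrite DK.
  by rewrite sumr_const -/m -mulr_natl -/m; ring.
rewrite /qform /bform (eq_bigr (fun u => (u \in Q)%:R * (l - 1 + m)^-1)) => [|u _].
  rewrite -mulr_suml; congr (_ * _).
  by rewrite /m -sumr_const [in RHS]big_mkcond; apply: eq_bigr => u _; case: (u \in Q).
rewrite /nbr_sum sumQ; case: (boolP (u \in Q)) => uQ; last by rewrite /= !mulr0n mulr0 !mul0r.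
rewrite (bigD1 u) //= ei add0r (eq_bigr (fun=> 1)) => [|v /andP[vQ vu]]; last first.
  by rewrite kQ // eq_sym.
rewrite sumr_const (_ : #|_| = #|Q|.-1); last first.
  rewrite [in RHS](cardsD1 u) uQ /=; apply: eq_card => v; rewrite !inE andbC //.
have -> : #|Q|.-1%:R = m - 1 :> R.
  by rewrite /m -[in RHS](prednK (_ : 0 < #|Q|)%N) ?card_gt0 // -natr1 addrK.
by field.
Qed.

(** Positivity is tested on [x - s y], the best multiple of the tail vector. *)
Lemma tail_bound (F : {set T}) K k (x : T -> R) : psd e l -> tail e l F K k ->
  (forall u, u \notin F -> x u = 0) ->
  k * (\sum_(u in F | K u) x u) ^+ 2 <= qform e l x.
Proof.
move=> P [y [y0 yK yq]] x0; set s := \sum_(u in F | _) _.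
have := P (fun v => 1 * x v + (- s) * y v); rewrite qform_lin // yq.
have -> : bform e l x y = k * s.
  rewrite /bform /s big_mkcondr mulr_sumr [RHS]big_mkcond; apply: eq_bigr => u _.
  case: (boolP (u \in F)) => uF; last by rewrite x0 // mul0r.
  by rewrite y0 // yK //; case: (K u) => /=; ring.
by clearbody s => H; lra.
Qed.

(** The descent to [F] follows a shortest path: a vertex of one layer has no neighbour two layers
    down, so within the smaller ball its tail is seen from the chosen predecessor only, and each
    step is one cone. *)
Lemma tail_descend (F : {set T}) j p k : 2 <= l -> k < 1 ->
  p \in gball e F j.+1 -> p \notin gball e F j ->
  tail e l (p |: gball e F j) (pred1 p) k ->
  exists p', (exists2 f, f \in F & e p' f) /\
    tail e l F (e p') (iter j.+1 (fun c => (l - c)^-1) k).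
Proof.
move=> l2; elim: j p k => [|j IH] p k k1 pB pN tl.
  exists p; have [u uF up] := gball_pred pB pN; split; first by exists u => //; rewrite es.
  have := tail_cone (setU11 _ _) _ tl; rewrite setU1K //=; apply; lra.
have [r rB rp] := gball_pred pB pN.
have rN : r \notin gball e F j by apply: contra pN => /gball_step; apply.
rewrite iterSr; apply: (IH r) => //.
  by rewrite invf_lt1; lra.
have kl : k < l by lra.
have := tail_cone (setU11 _ _) kl tl; rewrite setU1K //; apply: tail_sub.
  by rewrite subUset sub1set rB gball_mono.
move=> u /setU1P[->|uB] /=; first by rewrite eqxx es.
have -> : e p u = false by apply: contraNF pN; rewrite es; apply: gball_step.
by apply/esym; apply: contraNF rN => /eqP <-.
Qed.

End Tail.

Lemma half_le_or (a b c m n : nat) :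
  (a + b + 1 = c -> n < c -> 2 * m <= n -> m <= a \/ m <= b)%N.
Proof. lia. Qed.

(** * Heavy vertices *)

Section Extension.
Context {R : realType}.

(** The cone map is increasing and preserves [[c, 1[]. For [c = 1/s] the condition on [c] says
    [l <= s + 1/s]. *)
Lemma iter_cone_ge (l c k : R) n : 2 <= l -> c < 1 -> c <= (l - c)^-1 -> c <= k -> k < 1 ->
  c <= iter n (fun k => (l - k)^-1) k < 1.
Proof.
move=> l2 c1 lc ck k1; elim: n => [|n /andP[IH1 IH2]]; first by rewrite /= ck.
rewrite iterS; set b := iter _ _ _ in IH1 IH2 *; apply/andP; split.
  by apply: le_trans lc _; rewrite lef_pV2 ?posrE; lra.
by rewrite invf_lt1; lra.
Qed.

(** The iterates of 0 are the weights of paths; they increase to the smaller fixed point, with rate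
    [1/t^2]. *)
Lemma iter_cone_cvg (l t d : R) : 1 < t -> l = t + t^-1 -> 0 < d ->
  exists n0, forall n, (n0 <= n)%N -> t^-1 - d < iter n (fun k => (l - k)^-1) 0.
Proof.
move=> t1 lt d0; set a := t^-1; have t0 : 0 < t by lra.
have a0 : 0 < a by rewrite invr_gt0.
have a1 : a < 1 by rewrite invf_lt1.
have rate n : 0 <= iter n (fun k => (l - k)^-1) 0 <= a /\
    a - iter n (fun k => (l - k)^-1) 0 <= (a ^+ 2) ^+ n.
  elim: n => [|n [/andP[b0 ba] IH]]; first by rewrite /= lexx ltW //= expr0 subr0 ltW.
  rewrite iterS; move: (iter n _ _) b0 ba IH => b b0 ba IH.
  have lb : t <= l - b by rewrite lt -/a; lra.
  have lb0 : 0 < l - b by lra.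
  have ib : (l - b)^-1 <= a by rewrite lef_pV2 // posrE.
  have ib0 : 0 < (l - b)^-1 by rewrite invr_gt0.
  split; first by rewrite ib ltW.
  have -> : a - (l - b)^-1 = a * (l - b)^-1 * (a - b).
    have al : a = l - t by rewrite lt -/a; ring.
    by rewrite {3}al /a; field; rewrite !gt_eqF.
  rewrite exprS; apply: ler_pM; [by rewrite mulr_ge0 ?ltW|lra| |done].
  by rewrite expr2; apply: ler_pM => //; lra.
have [q0 q1] : 0 <= a ^+ 2 /\ a ^+ 2 < 1 by split; [exact: sqr_ge0|rewrite expr_lt1 // ltW].
have [n0 n0d] := exists_expr_lt q0 q1 d0; exists n0 => n nn.
have [_ H] := rate n.
have : (a ^+ 2) ^+ n <= (a ^+ 2) ^+ n0 by apply: ler_wiXn2l; rewrite // ltW.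
lra.
Qed.

(** The vector with [-2] at the centre and 1 on the five leaves has value [9 l - 20]. *)
Lemma no_claw5 (T : finType) (e : rel T) (l : R) c (I : {set T}) :
  symmetric e -> irreflexive e -> psd e l -> l < 20 / 9 ->
  (forall u, u \in I -> e c u) -> {in I &, forall u v, ~~ e u v} -> #|I| = 5%N -> False.
Proof.
move=> es ei P l2 cI II cardI; pose y (u : T) : R := (u \in I)%:R.
have sumI (P' : T -> bool) : \sum_u (P' u)%:R * y u = \sum_(u in I) (P' u)%:R :> R.
  by rewrite [RHS]big_mkcond; apply: eq_bigr => u _; rewrite /y; case: (u \in I); rewrite ?mulr1 ?mulr0.
have s5 : \sum_(u in I) (1 : R) = 5 by rewrite sumr_const cardI.
have cN : c \notin I by apply/negP => /cI; rewrite ei.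
have := P (fun v => (- 2) * delta R c v + 1 * y v).
rewrite qform_lin // qform_delta // bform_delta /nbr_sum sumI.
rewrite (eq_bigr (fun=> 1)) ?s5 => [|u uI]; last by rewrite cI.
have -> : qform e l y = 5 * l.
  rewrite /qform /bform (eq_bigr (fun u => (u \in I)%:R * y u * l)) => [|u _].
    rewrite -mulr_suml sumI (eq_bigr (fun=> 1)) ?s5 // => u ->//.
  case: (boolP (u \in I)) => uI; last by rewrite /y (negPf uI) /= !mulr0n !mul0r.
  rewrite /nbr_sum sumI big1 => [|v vI]; last by rewrite (negPf (II _ _ uI vI)).
  by rewrite /y uI /=; ring.
by rewrite /y (negPf cN) /= mulr0n; lra.
Qed.

(* A large connected graph has a long induced path or a large clique attached to
   [F]; at [l < s + 1/s] either one weighs at least [1/s] as seen from [F]. *)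
Lemma exists_heavy_vertex (s l : R) (n : nat) :
  1 < s -> 2 < l -> l < s + s^-1 -> l < 20 / 9 ->
  exists N : nat, forall (T : finType) (e : rel T) (F : {set T}),
    symmetric e -> irreflexive e -> connected_rel e -> psd e l -> (N < #|T|)%N ->
    F != set0 -> (#|F| <= n)%N ->
    exists p, (exists2 f, f \in F & e p f) /\
      forall x : T -> R, (forall u, u \notin F -> x u = 0) ->
        s^-1 * (\sum_(u in F | e p u) x u) ^+ 2 <= qform e l x.
Proof.
move=> s1 l2 ls l3; have [t t1 lt] := exists_param l2.
have s0 : 0 < s by lra.
have t0 : 0 < t by lra.
have st : t < s.
  rewrite lt_def (param_le t1 s1) -?lt ?ltW // andbT.
  by apply: contraTneq ls => ->; rewrite lt ltxx.
have si1 : s^-1 < 1 by rewrite invf_lt1.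
have si0 : 0 < s^-1 by rewrite invr_gt0.
have sti : s^-1 < t^-1 by rewrite ltf_pV2.
have sfix : (l - s^-1)^-1 >= s^-1 by rewrite lef_pV2 ?posrE; lra.
have d0 : 0 < t^-1 - s^-1 by lra.
have [k kP] := iter_cone_cvg t1 lt d0.
pose m1 := (Num.truncn ((l - 1) / (1 - s^-1))).+1.
have m1P m : (m1 <= m)%N -> s^-1 <= m%:R / (l - 1 + m%:R) < 1.
  move=> mm; have /truncn_itv/andP[_ H] : 0 <= (l - 1) / (1 - s^-1) by apply: divr_ge0; lra.
  have mm' : (l - 1) / (1 - s^-1) < m%:R.
    by apply: lt_le_trans H _; rewrite ler_nat.
  have m0 : 0 < m%:R :> R by rewrite ltr0n; apply: leq_trans mm.
  have lm : 0 < l - 1 + m%:R by lra.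
  have s1' : 0 < 1 - s^-1 by lra.
  rewrite ltr_pdivrMr // ler_pdivlMr //.
  have sl1 : s^-1 * (l - 1) <= 1 * (l - 1) by apply: ler_wpM2r; lra.
  by move: mm'; rewrite ltr_pdivrMr // => mm'; apply/andP; split; lra.
(* More than [n] vertices cannot all lie in [F]; more than [2 m1] leave, after removal of one vertex
   and a split in two, a part with at least [m1]. The factor in [cl] pays for the pigeonhole on
   distance to [F] and neighbours in [F], the 5 in [M] for [no_claw5]. *)
pose m0 := maxn n (2 * m1).
pose cl := (#|{: 'I_k.+1 * {ffun 'I_n -> bool}}| * m0).+1.
pose M := (2 ^ (cl + 5))%N.
exists (n * M ^ k)%N => T e F es ei ec P cT F0 cF.
suff [p [pF [c sc tl]]] : exists p, (exists2 f, f \in F & e p f) /\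
    exists2 c, s^-1 <= c & tail e l F (e p) c.
  exists p; split=> // x x0; apply: le_trans _ (tail_bound es P tl x0).
  by rewrite ler_wpM2r // sqr_ge0.
have heavy j p c : s^-1 <= c -> c < 1 -> p \in gball e F j.+1 -> p \notin gball e F j ->
    tail e l (p |: gball e F j) (pred1 p) c ->
    exists p', (exists2 f, f \in F & e p' f) /\
      exists2 c', s^-1 <= c' & tail e l F (e p') c'.
  move=> sc c1 pB pN tl; have [p' [pF tl']] := tail_descend es ei (ltW l2) c1 pB pN tl.
  exists p'; split=> //; exists (iter j.+1 (fun c => (l - c)^-1) c) => //.
  by have /andP[] := iter_cone_ge j.+1 (ltW l2) si1 sfix sc c1.
have [Bk|Bk] := eqVneq (gball e F k) setT; last first.
  have [p pB pN] : exists2 p, p \in gball e F k.+1 & p \notin gball e F k.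
    have [p pB|H] := pickP (fun p => (p \in gball e F k.+1) && (p \notin gball e F k)).
      by exists p; case/andP: pB.
    case/eqP: Bk; apply: ec => [|u v uB uv].
      have /set0Pn[f fF] := F0; apply/set0Pn; exists f.
      exact: (subsetP (@gball_mono _ e F 0 k (leq0n k))).
    by have := H v; rewrite (gball_step uB uv) /= => /negbFE.
  have [p' [pF tl]] := tail_descend es ei (ltW l2) ltr01 pB pN (tail0 _ _ _ _).
  exists p'; split=> //; eexists; last exact: tl.
  by have := kP _ (leqnSn k); lra.
have [c degc] : exists c, (M <= #|[set v | e c v]|)%N.
  apply/existsP; apply: contraLR cT; rewrite negb_exists => /forallP H.
  rewrite -leqNgt -cardsT -Bk; apply: leq_trans (_ : #|F| * M ^ k <= _)%N.
    by apply: card_gball => u; rewrite ltnNge.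
  by rewrite leq_mul2r cF orbT.
have [[Q [QA cQ kQ]]|[I [IA cI II]]] := ramsey es ei degc; last first.
  case: (@no_claw5 _ e l c I) => // u /(subsetP IA); by rewrite inE.
have /set0Pn[f0 f0F] := F0.
pose lay u := find (fun j => u \in gball e F j) (iota 0 k.+1).
have layP u : [/\ (lay u < k.+1)%N, u \in gball e F (lay u) &
    forall j, (j < lay u)%N -> u \notin gball e F j].
  have hs : has (fun j => u \in gball e F j) (iota 0 k.+1).
    by apply/hasP; exists k; rewrite ?mem_iota ?Bk ?inE //= add0n ltnS leqnn.
  have lk : (lay u < k.+1)%N by rewrite -[X in (_ < X)%N](size_iota 0) -has_find.
  split=> //; first by have := nth_find 0 hs; rewrite nth_iota.
  move=> j jl; have := before_find 0 jl; rewrite nth_iota ?(ltn_trans jl lk) //.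
  by move=> ->.
pose ty u : 'I_k.+1 * {ffun 'I_n -> bool} :=
  (inord (lay u), [ffun i : 'I_n => e u (nth f0 (enum F) i)]).
have [[i g] cQ'] := @pigeonhole_fiber _ _ ty Q m0 (eq_leq (esym cQ)).
set Q' := [set u in Q | _] in cQ'.
have kQ' (A : {set T}) : A \subset Q' -> clique e A.
  move=> /subsetP AQ u v uA vA; apply: kQ.
    by have := AQ _ uA; rewrite inE => /andP[].
  by have := AQ _ vA; rewrite inE => /andP[].
have QP : {in Q' &, forall u v, lay u = lay v /\ {in F, e u =1 e v}}.
  move=> u v; rewrite !inE => /andP[_ /eqP tu] /andP[_ /eqP tv].
  have [lu lv] : inord (lay u) = i /\ inord (lay v) = i by case: tu; case: tv.
  split=> [|w wF].
    have [] := layP u; have [] := layP v => lv' _ _ lu' _ _.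
    by rewrite -(inordK lu') -(inordK lv') lu lv.
  have iw : (index w (enum F) < n)%N.
    by apply: leq_trans cF; rewrite cardE index_mem mem_enum.
  have gE v' : ty v' = (i, g) -> e v' w = g (Ordinal iw).
    by move=> /(congr1 snd) /= <-; rewrite ffunE nth_index ?mem_enum.
  by rewrite !gE.
have /card_gt0P[u uQ] : (0 < #|Q'|)%N by apply: leq_ltn_trans cQ'.
have clP (A : {set T}) : A \subset Q' -> (m1 <= #|A|)%N ->
    exists c, [/\ s^-1 <= c, c < 1 & forall (D : {set T}) K, [disjoint D & A] ->
      {in D & A, forall u v, e u v = K u} -> tail e l D K c].
  move=> AQ mA; have /andP[H1 H2] := m1P _ mA.
  exists (#|A|%:R / (l - 1 + #|A|%:R)); split=> // D K DA DK.
  apply: tail_clique => //; [exact: kQ' | | lra].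
  by rewrite -card_gt0; apply: leq_trans mA.
have nm : (n <= m0)%N by rewrite leq_maxl.
have mm : (2 * m1 <= m0)%N by rewrite leq_maxr.
have uQ' : (u \in Q) && (ty u == (i, g)) by move: uQ; rewrite inE.
have [_ uB uN] := layP u.
case El : (lay u) uB uN => [|[|j]] uB uN.
- suff : (#|Q'| <= n)%N by move=> QF; have := leq_trans cQ' (leq_trans QF nm); rewrite ltnn.
  apply: leq_trans cF; apply: subset_leq_card; apply/subsetP => v vQ.
  by have [_ vB _] := layP v; move: vB; have [<- _] := QP _ _ uQ vQ; rewrite El.
- have [f fF fu] := gball_pred uB (uN 0%N isT).
  exists u; split; first by exists f => //; rewrite es.
  have [|c' [sc _ H]] := clP _ (subxx Q').
    by apply: leq_trans (ltnW cQ'); apply: leq_trans mm; rewrite leq_pmull.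
  exists c' => //; apply: H.
    rewrite disjoint_sym disjoint_subset; apply/subsetP => v vQ; apply/negP => vF.
    have [_ _ vN] := layP v; move: vN; have [<- _] := QP _ _ uQ vQ; rewrite El.
    by move=> /(_ 0%N isT); rewrite vF.
  by move=> w v wF vQ /=; rewrite es; have [_ ->] := QP _ _ vQ uQ.
have [r rB ru] := gball_pred uB (uN j.+1 (ltnSn _)).
have rN : r \notin gball e F j by apply: contra (uN j.+1 (ltnSn _)) => /gball_step; apply.
have QN v w : v \in Q' -> w \in gball e F j -> e w v = false.
  move=> vQ wB; apply/negP => wv; have [_ _ vN] := layP v; move: vN.
  have [<- _] := QP _ _ uQ vQ; rewrite El => /(_ j.+1 (ltnSn _)).
  by rewrite (gball_step wB wv).
have QB v : v \in Q' -> v \notin gball e F j.+1.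
  move=> vQ; have [_ _ vN] := layP v; move: vN.
  by have [<- _] := QP _ _ uQ vQ; rewrite El => /(_ j.+1 (ltnSn _)).
have QD v : v \in Q' -> v \notin r |: gball e F j.
  move=> vQ; rewrite !inE negb_or; apply/andP; split.
    by apply: contraNneq (QB v vQ) => ->.
  by apply: contra (QB v vQ); apply/subsetP/gball_mono.
(* The clique is attached to [r] directly if [r] sees many of its vertices. Otherwise the unseen
   ones are attached to [u] alone and [u] becomes one more path vertex before [r]. *)
pose A := [set v in Q' :\ u | e r v]; pose A' := [set v in Q' :\ u | ~~ e r v].
have AA : (m1 <= #|A|)%N \/ (m1 <= #|A'|)%N.
  apply: half_le_or cQ' mm; rewrite (cardsD1 u Q') uQ addnC; congr (_ + _)%N.
  rewrite -(cardsID [set v | e r v] (Q' :\ u)); congr (_ + _)%N; apply: eq_card => v.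
    by rewrite !inE.
  by rewrite !inE andbC.
have AQ (B : {set T}) : B \subset Q' :\ u -> B \subset Q'.
  by move=> /subset_trans; apply; apply: subsetDl.
have AQ1 : A \subset Q' by apply: AQ; apply/subsetP => v; rewrite inE => /andP[].
have AQ2 : A' \subset Q' by apply: AQ; apply/subsetP => v; rewrite inE => /andP[].
case: AA => [/(clP _ AQ1)|/(clP _ AQ2)] [c' [sc c1 H]].
  apply: (heavy j r c') => //; apply: H.
    by rewrite disjoint_sym disjoint_subset; apply/subsetP => v /(subsetP AQ1) /QD.
  move=> w v /setU1P[->|wB] vA /=; first by move: vA; rewrite eqxx inE => /andP[].
  rewrite (QN _ _ (subsetP AQ1 _ vA) wB); apply/esym/negbTE.
  by apply: contraNneq rN => <-.
have tl : tail e l (u |: (r |: gball e F j)) (pred1 u) c'.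
  apply: H.
    rewrite disjoint_sym disjoint_subset; apply/subsetP => v vA.
    rewrite inE in_setU1 negb_or QD ?(subsetP AQ2) // andbT.
    by move: vA; rewrite !inE => /andP[/andP[]].
  move=> w v /setU1P[->|wD] vA /=.
    move: (vA); rewrite !inE eqxx => /andP[/andP[vu vQ'] _].
    have [uQQ vQQ] : u \in Q /\ v \in Q by case/andP: vQ' => vQQ _; case/andP: (uQ'); split.
    by apply: kQ; rewrite // eq_sym.
  have vQ := subsetP AQ2 _ vA; have -> : (w == u) = false.
    by apply: contraNF (QD _ uQ) => /eqP <-.
  case/setU1P: wD => [->|wB]; last by rewrite (QN _ _ vQ wB).
  by apply/negbTE; move: vA; rewrite inE => /andP[].
have uD := QD _ uQ.
have cl' : c' < l by apply: lt_trans c1 _; apply: lt_trans l2; rewrite ltr1n.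
have := tail_cone es ei (setU11 _ _) cl' tl; rewrite setU1K // => tl'.
have /andP[g1 g2] := iter_cone_ge 1 (ltW l2) si1 sfix sc c1.
apply: (heavy j r (l - c')^-1) => //.
apply: tail_sub tl' => // w /setU1P[->|wB] /=; first by rewrite eqxx es.
rewrite es (QN _ _ uQ wB); apply/esym/negbTE.
by apply: contraNneq rN => <-.
Qed.

End Extension.

(** * False twins and clique covers *)

Definition twin (T : finType) (e : rel T) : rel T :=
  fun u v => [forall w, e u w == e v w].

(** On a triangle this is the odd triangle of line graph theory: some vertex sees one or all three
    of its corners. The corners themselves see two and never count. *)
Definition odd3 (T : finType) (e : rel T) (u v w : T) : bool :=
  [exists z, e z u (+) e z v (+) e z w].

Section Krausz.
Context {R : realFieldType} {T : finType}.

(** With [N] the incidence matrix of vertices and cliques, [N N^T] has [e] off the diagonal and the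
    number of cliques through [c] on it. *)
Lemma clique_cover_ge0 (e : rel T) (S : {set T}) (P : {set {set T}}) (w : T -> nat)
    (s : T -> R) :
  irreflexive e ->
  (forall L, L \in P -> L \subset S) ->
  {in S &, forall c d, c != d ->
     #|[set L in P | (c \in L) && (d \in L)]| = e c d} ->
  {in S, forall c, (#|[set L in P | c \in L]| <= w c)%N} ->
  0 <= \sum_(c in S) ((w c)%:R * s c ^+ 2 + \sum_(d in S) (e c d)%:R * s c * s d).
Proof.
move=> ei PS P2 P1.
have cardE (Q : pred {set T}) : \sum_(L in P | Q L) (1 : R) = #|[set L in P | Q L]|%:R.
  by rewrite sumr_const; congr (_ *+ _); apply: eq_card => L; rewrite !inE.
have H : 0 <= \sum_(L in P) (\sum_(c in L) s c) ^+ 2.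
  by apply: sumr_ge0 => L _; apply: sqr_ge0.
apply: le_trans H _.
have -> : \sum_(L in P) (\sum_(c in L) s c) ^+ 2 =
    \sum_(c in S) \sum_(d in S) #|[set L in P | (c \in L) && (d \in L)]|%:R * s c * s d.
  transitivity (\sum_(L in P) \sum_(c in S) \sum_(d in S)
      ((c \in L) && (d \in L))%:R * s c * s d).
    apply: eq_bigr => L LP; rewrite expr2 mulr_suml.
    rewrite [RHS](bigID (fun c => c \in L)) /= [X in _ = _ + X]big1 ?addr0; last first.
      by move=> c /andP[_ /negPf->]; rewrite big1 // => d _; rewrite /= !mul0r.
    have SL F : \sum_(c in S | c \in L) F c = \sum_(c in L) (F c : R).
      apply: eq_bigl => c; rewrite andbC; case: (boolP (c \in L)) => //= cL.
      by rewrite (subsetP (PS _ LP)).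
    rewrite SL; apply: eq_bigr => c cL; rewrite cL mulr_sumr -SL.
    rewrite [RHS](bigID (fun c => c \in L)) /= [X in _ = _ + X]big1 ?addr0; last first.
      by move=> d /andP[_ /negPf->]; rewrite !mul0r.
    by apply: eq_bigr => d /andP[_ ->]; rewrite mul1r.
  rewrite exchange_big /=; apply: eq_bigr => c cS.
  rewrite exchange_big /=; apply: eq_bigr => d dS.
  rewrite -cardE !mulr_suml [RHS]big_mkcondr /=; apply: eq_bigr => L _.
  by case: ifP => _; rewrite ?mul0r.
apply: ler_sum => c cS.
rewrite (bigD1 c) //= [in leRHS](bigD1 c) //= ei !mul0r add0r.
apply: lerD.
  rewrite -mulrA -expr2 ler_wpM2r ?sqr_ge0 // ler_nat.
  by apply: leq_trans (P1 _ cS); apply/eq_leq/eq_card => L; rewrite !inE andbb.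
apply: ler_sum => d /andP[dS dc].
by rewrite P2 // eq_sym.
Qed.

Lemma twin_sym (e : rel T) : symmetric (twin e).
Proof. by move=> u v; apply: eq_forallb => w; rewrite eq_sym. Qed.

Lemma twin_trans (e : rel T) : transitive (twin e).
Proof.
move=> v u w /forallP uv /forallP vw; apply/forallP => z.
by rewrite (eqP (uv z)) vw.
Qed.

Lemma twin_refl (e : rel T) : reflexive (twin e).
Proof. by move=> u; apply/forallP. Qed.

Lemma twinE (e : rel T) u v w : twin e u v -> e u w = e v w.
Proof. by move=> /forallP/(_ w)/eqP. Qed.

Lemma odd3_swap12 (e : rel T) u v w : odd3 e u v w = odd3 e v u w.
Proof. by apply: eq_existsb => z; rewrite [e z u (+) _]addbC. Qed.

Lemma odd3_swap23 (e : rel T) u v w : odd3 e u v w = odd3 e u w v.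
Proof. by apply: eq_existsb => z; rewrite addbAC. Qed.

Lemma odd3_all (e : rel T) u v w z : e z u -> e z v -> e z w -> odd3 e u v w.
Proof. by move=> zu zv zw; apply/existsP; exists z; rewrite zu zv zw. Qed.

(* In a line graph the odd triangles are the concurrent ones, except in small
   components.  Hence, on representatives of the twin classes, the cliques formed
   by an edge [u v] and the vertices completing it to an odd triangle cover every
   edge once and every vertex at most twice (at most once if it has a twin). *)
Lemma psd2_of_local (e : rel T) :
  symmetric e -> irreflexive e ->
  (forall x y z, twin e x y -> twin e x z -> x != y -> x != z -> y = z) ->
  (forall c x y z, e c x -> e c y -> e c z -> ~~ e x y -> ~~ e x z -> ~~ e y z ->
     [|| twin e x y, twin e x z | twin e y z]) ->
  (forall u w v y, e u w -> e u v -> e w v -> e u y -> e w y ->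
     odd3 e u w v -> odd3 e u w y -> e v y || twin e v y) ->
  (forall u u' v y, twin e u u' -> u != u' -> e u v -> e u y -> e v y || twin e v y) ->
  (forall u u' v y, twin e u u' -> u != u' -> e u v -> e u y -> e v y -> odd3 e u v y) ->
  psd e (2 : R).
Proof.
move=> es ei Htriple Hclaw Hdiamond Hnbr Htri x.
pose rp u := choose (twin e u) u.
have rpP u : twin e u (rp u) by apply: chooseP; apply: twin_refl.
have rpE u v : twin e u v -> rp u = rp v.
  move=> uv; rewrite /rp; have E : twin e u =1 twin e v.
    by move=> w; apply/idP/idP; apply: twin_trans; rewrite // twin_sym.
  by rewrite (eq_choose E); apply: choose_id; rewrite -?E ?twin_refl.
have erp u v : e u v = e (rp u) (rp v).
  by rewrite (twinE v (rpP u)) es (twinE _ (rpP v)) es.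
pose S := [set u | rp u == u].
have rpS u : rp u \in S by rewrite inE -(rpE _ _ (rpP u)).
have twS : {in S &, forall u v, twin e u v -> u = v}.
  by move=> u v; rewrite !inE => /eqP {2}<- /eqP {2}<- /rpE.
pose s a := \sum_(u | rp u == a) x u.
(* A twin pair satisfies only [2 (x^2 + y^2) >= (x + y)^2]: merging it costs half of the diagonal,
   whence the stricter bound of one clique. *)
pose w (a : T) : nat := if [exists u, twin e a u && (a != u)] then 1%N else 2.
have split_rp (F : T -> R) : \sum_u F u = \sum_(a in S) \sum_(u | rp u == a) F u.
  by rewrite (partition_big rp (mem S)) //= => u _; apply: rpS.
have sq a : a \in S -> (w a)%:R * s a ^+ 2 <= 2 * \sum_(u | rp u == a) x u ^+ 2.
  rewrite inE => aS; rewrite /s (bigD1 a) //= [in leRHS](bigD1 a) //= /w.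
  have cls u : rp u == a = twin e a u.
    apply/eqP/idP => [<-|/rpE <-]; last exact/eqP.
    by rewrite twin_sym rpP.
  case: existsP => [[u /andP[au na]]|H].
    have E (F : T -> R) : \sum_(v | (rp v == a) && (v != a)) F v = F u.
      rewrite (bigD1 u) /= ?cls ?au 1?eq_sym // big1 ?addr0 // => v.
      rewrite cls => /andP[/andP[av va]]; rewrite (Htriple a u v) ?eqxx //.
      by rewrite eq_sym.
    by rewrite !E; have := sqr_ge0 (x a - x u); lra.
  rewrite !big_pred0 ?addr0 // => v; apply/negP; rewrite cls => /andP[av va];
    by case: H; exists v; rewrite av eq_sym.
apply: le_trans (_ : \sum_(a in S) ((w a)%:R * s a ^+ 2 +
   \sum_(b in S) (e a b)%:R * s a * s b) <= _); last first.
  rewrite /qform /bform split_rp; apply: ler_sum => a aS.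
  under [leRHS]eq_bigr do rewrite mulrDr mulrCA -expr2.
  rewrite big_split /= -mulr_sumr lerD ?sq // /nbr_sum.
  rewrite le_eqVlt; apply/orP; left; apply/eqP.
  under [RHS]eq_bigr => u ua do rewrite split_rp mulr_sumr.
  rewrite exchange_big /=; apply: eq_bigr => b bS.
  rewrite mulrAC [s a]/s mulr_sumr; apply: eq_bigr => u /eqP ua.
  rewrite mulrAC [s b]/s !mulr_sumr; apply: eq_bigr => v /eqP vb.
  by rewrite (erp u v) ua vb; ring.
clearbody S.
pose L u v := [set c in S | [|| c == u, c == v | [&& e u c, e v c & odd3 e u v c]]].
have LC u v : L u v = L v u.
  apply/setP => c; rewrite !inE odd3_swap12 [e u c && _]andbCA.
  by case: (c == u); case: (c == v).
have Lu u v : u \in S -> u \in L u v by move=> uS; rewrite inE uS eqxx.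
have Lv u v : v \in S -> v \in L u v by move=> uS; rewrite inE uS eqxx orbT.
have diamond u v c d : u \in S -> v \in S -> c \in S -> d \in S -> e u v -> c != d ->
    [&& e u c, e v c & odd3 e u v c] -> [&& e u d, e v d & odd3 e u v d] -> e c d.
  move=> uS vS cS dS uv cd /and3P[uc vc oc] /and3P[ud vd od].
  have := Hdiamond _ _ _ _ uv uc vc ud vd oc od; case: (e c d) => //= /(twS _ _ cS dS).
  by move/eqP: cd.
have Lsub u v c : u \in S -> v \in S -> e u v -> c != u -> c != v -> c \in L u v ->
    L u v \subset L u c.
  move=> uS vS uv cu cv; rewrite inE (negPf cu) (negPf cv) /= => /andP[cS ouv].
  apply/subsetP => d; rewrite !inE => /andP[dS]; rewrite dS /=.
  have [->//|du] := eqVneq d u; have [->|dv] /= := eqVneq d v.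
    by move=> _; case/and3P: ouv => uc vc oc; rewrite uv (es c) vc odd3_swap23 oc orbT.
  have [//|dc] /= := eqVneq d c => odd.
  have cd := diamond _ _ _ _ uS vS cS dS uv _ ouv odd.
  case/and3P: ouv => uc vc _; case/and3P: odd => ud vd _.
  by rewrite ud cd 1?eq_sym // (@odd3_all _ _ _ _ v) // es.
have Leq1 u v c : u \in S -> v \in S -> e u v -> c != u -> c != v -> c \in L u v ->
    L u v = L u c.
  move=> uS vS uv cu cv cL; apply/eqP; rewrite eqEsubset Lsub //=.
  have := cL; rewrite inE (negPf cu) (negPf cv) /= => /andP[cS /and3P[uc vc oc]].
  apply: Lsub; rewrite // 1?eq_sym //; first by apply: contraTneq uv => <-; rewrite ei.
  by rewrite inE vS uv (es c) vc odd3_swap23 oc !orbT.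
(* Any two members of a clique generate it, so each edge lies in exactly one. *)
have Leq u v c d : u \in S -> v \in S -> e u v -> c != d -> c \in L u v -> d \in L u v ->
    e c d /\ L u v = L c d.
  move=> uS vS uv cd cL dL.
  have third a b c' : a \in S -> b \in S -> e a b -> c' != a -> c' != b -> c' \in L a b ->
      [/\ c' \in S, e a c', e b c' & L a b = L a c'].
    move=> aS bS ab ca cb cL'; have -> := Leq1 _ _ _ aS bS ab ca cb cL'.
    by move: cL'; rewrite inE (negPf ca) (negPf cb) /= => /andP[-> /and3P[-> -> _]].
  have [cu|cu] := eqVneq c u.
    have [dv|dv] := eqVneq d v; first by rewrite cu dv.
    have [] := third u v d uS vS uv; rewrite // -?cu 1?eq_sym //.
  have [du|du] := eqVneq d u.
    have [cv|cv] := eqVneq c v; first by rewrite du cv LC es.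
    by have [_ uc _ ->] := third u v c uS vS uv cu cv cL; rewrite du LC es.
  have [cv|cv] := eqVneq c v.
    rewrite LC in dL *; rewrite es in uv.
    by have [] := third v u d vS uS uv; rewrite // -?cv 1?eq_sym.
  have [cS uc vc E] := third u v c uS vS uv cu cv cL.
  have [dv|dv] := eqVneq d v.
    rewrite dv es; split=> //; rewrite LC in cL *; rewrite es in uv.
    by have [_ _ _ ->] := third v u c vS uS uv cv cu cL; rewrite LC.
  rewrite E LC in dL *; rewrite es in uc.
  have dc : d != c by rewrite eq_sym.
  by have [_ ? _ ->] := third c u d cS uS uc dc du dL.
pose P := [set L p.1 p.2 | p in [set p : T * T | [&& p.1 \in S, p.2 \in S & e p.1 p.2]]].
have PP K : K \in P -> exists u v, [/\ u \in S, v \in S, e u v & K = L u v].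
  by move=> /imsetP[[u v]]; rewrite inE /= => /and3P[uS vS uv] ->; exists u, v.
have inP u v : u \in S -> v \in S -> e u v -> L u v \in P.
  by move=> uS vS uv; apply/imsetP; exists (u, v); rewrite ?inE /= ?uS ?vS.
have at_c c K : K \in P -> c \in K -> exists b, [/\ b \in S, e c b & K = L c b].
  move=> /PP[u [v [uS vS uv ->]]] cK; have [cu|cu] := eqVneq c u.
    by exists v; rewrite cu.
  by exists u; have [cE LE] := Leq u v c u uS vS uv cu cK (Lu _ _ uS).
have same c b d : c \in S -> b \in S -> d \in S -> e c b -> e c d -> b != d ->
    e b d && odd3 e c b d -> L c b = L c d.
  move=> cS bS dS cb cd bd /andP[ebd o].
  have dL : d \in L c b by rewrite inE dS cd ebd o !orbT.
  have ncd : c != d by apply: contraTneq cd => ->; rewrite ei.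
  by have [] := Leq c b c d cS bS cb ncd (Lu _ _ cS) dL.
apply: (@clique_cover_ge0 e S P) => //.
- by move=> K /PP[u [v [_ _ _ ->]]]; apply/subsetP => c; rewrite inE => /andP[].
- move=> c d cS dS cd; case: (boolP (e c d)) => ecd.
    rewrite (_ : [set _ in _ | _] = [set L c d]) ?cards1 //.
    apply/setP => K; rewrite !inE; apply/and3P/eqP => [[KP cK dK]|->]; last first.
      by rewrite inP ?Lu ?Lv.
    have [u [v [uS vS uv KE]]] := PP _ KP; rewrite KE in cK dK *.
    by have [] := Leq u v c d uS vS uv cd cK dK.
  apply/eqP; rewrite cards_eq0 -subset0; apply/subsetP => K; rewrite !inE.
  case/and3P => /PP[u [v [uS vS uv ->]]] cK dK.
  by have [ecd'] := Leq u v c d uS vS uv cd cK dK; rewrite ecd' in ecd.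
move=> c cS; rewrite /w; case: existsP => [[u /andP[cu ncu]]|_].
  rewrite leqNgt; apply/negP => /card_gt1P[K1 [K2 []]]; rewrite !inE.
  move=> /andP[/at_c H1 /H1[b [bS cb ->]]] /andP[/at_c H2 /H2[d [dS cd ->]]].
  apply/negP; rewrite negbK; have [->//|bd] := eqVneq b d.
  apply/eqP/same => //; have := Hnbr _ _ _ _ cu ncu cb cd.
  case/orP => [ebd|/(twS _ _ bS dS)]; last by move/eqP: bd.
  by rewrite ebd /=; apply: (Htri _ _ _ _ cu ncu).
(* Three cliques through [c] would give a claw on distinct representatives, although two of its
   leaves must be twins. *)
rewrite leqNgt; apply/negP => /card_gt2P[K1 [K2 [K3 []]]] []; rewrite !inE.
move=> /andP[/at_c H1 /H1[a [aS ca ->]]] /andP[/at_c H2 /H2[b [bS cb ->]]].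
move=> /andP[/at_c H3 /H3[d [dS cd ->]]] [Nab Nbd Nda].
have sep p q : p \in S -> q \in S -> e c p -> e c q -> L c p != L c q ->
    p != q /\ (e p q -> ~~ odd3 e c p q).
  move=> pS qS cp cq Npq; have pq : p != q by apply: contra Npq => /eqP ->.
  split=> // epq; apply: contra Npq => o; apply/eqP/same => //; exact/andP.
have nadj p q r : p \in S -> q \in S -> r \in S -> e c p -> e c q -> e c r ->
    L c p != L c q -> L c q != L c r -> L c p != L c r -> ~~ e p q.
  (* An even triangle [c p q] forces [r] to see exactly one of [p], [q]; the
     triangle it forms is even as well, so the two remaining apices are twins. *)
  move=> pS qS rS cp cq cr Npq Nqr Npr; apply/negP => epq.
  have [pq opq] := sep _ _ pS qS cp cq Npq.
  have [qr oqr] := sep _ _ qS rS cq cr Nqr.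
  have [pr opr] := sep _ _ pS rS cp cr Npr.
  have ev z : e z c (+) e z p (+) e z q = false.
    by apply/negbTE/negP => Hz; case/negP: (opq epq); apply/existsP; exists z.
  have := ev r; rewrite es cr !(es r); case: (boolP (e p r)) => epr; case: (boolP (e q r)) => eqr //= _.
    have ev2 z : e z c (+) e z p (+) e z r = false.
      by apply/negbTE/negP => Hz; case/negP: (opr epr); apply/existsP; exists z.
    case/eqP: qr; apply: twS => //; apply/forallP => z; rewrite !(es _ z).
    by have := ev z; have := ev2 z; case: (e z c); case: (e z p); case: (e z q); case: (e z r).
  have ev2 z : e z c (+) e z q (+) e z r = false.
    by apply/negbTE/negP => Hz; case/negP: (oqr eqr); apply/existsP; exists z.
  case/eqP: pr; apply: twS => //; apply/forallP => z; rewrite !(es _ z).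
  by have := ev z; have := ev2 z; case: (e z c); case: (e z p); case: (e z q); case: (e z r).
have Nba : L c b != L c a by rewrite eq_sym.
have Nad : L c a != L c d by rewrite eq_sym.
have Ndb : L c d != L c b by rewrite eq_sym.
have := Hclaw c a b d ca cb cd (nadj a b d aS bS dS ca cb cd Nab Nbd Nad)
  (nadj a d b aS dS bS ca cd cb Nad Ndb Nab) (nadj b d a bS dS aS cb cd ca Nbd Nda Nba).
case/or3P => /twS E.
- by move: Nab; rewrite (E aS bS) eqxx.
- by move: Nad; rewrite (E aS dS) eqxx.
- by move: Nbd; rewrite (E bS dS) eqxx.
Qed.

End Krausz.

(** * Excluded configurations *)

(* A quadratic form in [n] variables is the list of its upper triangular rows,
   each one split into the diagonal entry and the entries to its right. *)
Definition zform := seq (BinNums.Z * seq BinNums.Z).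

Fixpoint schur_row (d a : BinNums.Z) (r m : seq BinNums.Z) : seq BinNums.Z :=
  match r, m with
  | x :: r', y :: m' => BinInt.Z.sub (BinInt.Z.mul d x) (BinInt.Z.mul a y) :: schur_row d a r' m'
  | _, _ => [::]
  end.

Fixpoint schur (d : BinNums.Z) (F : zform) (m : seq BinNums.Z) : zform :=
  match F, m with
  | (x, r) :: F', a :: m' =>
    (BinInt.Z.sub (BinInt.Z.mul d x) (BinInt.Z.mul a a), schur_row d a r m') :: schur d F' m'
  | _, _ => [::]
  end.

(* Fraction-free Gaussian elimination, looking for a negative pivot. *)
Fixpoint neg_pivot (n : nat) (F : zform) : bool :=
  match n, F with
  | n'.+1, (d, m) :: F' =>
    match d with
    | BinNums.Z0 => neg_pivot n' F'
    | BinNums.Zneg _ => true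
    | BinNums.Zpos _ => neg_pivot n' (schur d F' m)
    end
  | _, _ => false
  end.

Fixpoint wf_form (F : zform) : bool :=
  if F is (_, m) :: F' then (size m == size F') && wf_form F' else true.

Section Eval.
Context {R : realFieldType}.

Definition ZtoR (z : BinNums.Z) : R := (int_of_Z z)%:~R.

Fixpoint dot (m x : seq R) : R :=
  match m, x with a :: m', b :: x' => a * b + dot m' x' | _, _ => 0 end.

Fixpoint eval_form (F : zform) (x : seq R) : R :=
  match F, x with
  | (d, m) :: F', a :: x' => ZtoR d * a ^+ 2 + 2 * a * dot (map ZtoR m) x' + eval_form F' x'
  | _, _ => 0
  end.

Lemma ZtoRM a b : ZtoR (BinInt.Z.mul a b) = ZtoR a * ZtoR b.
Proof. by rewrite /ZtoR -[BinInt.Z.mul a b]/(a * b)%R rmorphM intrM. Qed.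

Lemma ZtoRB a b : ZtoR (BinInt.Z.sub a b) = ZtoR a - ZtoR b.
Proof. by rewrite /ZtoR -[BinInt.Z.sub a b]/(a - b)%R rmorphB intrB. Qed.

Lemma ZtoR_nat n : ZtoR (BinInt.Z.of_nat n) = n%:R.
Proof. by rewrite /ZtoR (Z_of_intK (Posz n)). Qed.

Lemma size_schur d F m : size (schur d F m) = minn (size F) (size m).
Proof. by elim: F m => [|[x r] F IH] [|a m] //=; rewrite ?min0n // IH minnSS. Qed.

Lemma size_schur_row d a r m : size (schur_row d a r m) = minn (size r) (size m).
Proof. by elim: r m => [|x r IH] [|y m] //=; rewrite ?min0n // IH minnSS. Qed.

Lemma wf_schur d F m : wf_form F -> size m = size F -> wf_form (schur d F m).
Proof.
elim: F m => [|[x r] F IH] [|a m] //= /andP[/eqP sr wF] [sm].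
by rewrite size_schur_row size_schur sr sm minnn eqxx IH.
Qed.

Lemma dot_schur_row d a r m x : size r = size m ->
  dot (map ZtoR (schur_row d a r m)) x =
  ZtoR d * dot (map ZtoR r) x - ZtoR a * dot (map ZtoR m) x.
Proof.
elim: r m x => [|p r IH] [|q m] [|b x] //=; try by move=> _; ring.
by move=> [s]; rewrite IH // ZtoRB !ZtoRM; ring.
Qed.

Lemma eval_schur d F m x : wf_form F -> size m = size F ->
  eval_form (schur d F m) x =
  ZtoR d * eval_form F x - dot (map ZtoR m) x ^+ 2.
Proof.
elim: F m x => [|[p r] F IH] [|a m] [|b x] //=; try by move=> *; ring.
move=> /andP[/eqP sr wF] [sm]; rewrite IH // dot_schur_row ?sr ?sm //.
by rewrite ZtoRB !ZtoRM; ring.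
Qed.

Lemma eval_form0 F n : eval_form F (nseq n 0) = 0.
Proof.
elim: F n => [|[d m] F IH] [|n] //=.
by rewrite IH; ring.
Qed.

Lemma neg_pivotP n F : wf_form F -> neg_pivot n F ->
  exists x : seq R, size x = size F /\ eval_form F x < 0.
Proof.
elim: n F => [|n IH] [|[d m] F] //= /andP[/eqP sm wF].
case: d => [|p|p] /=.
(* At a zero pivot the variable is set to zero, which is sound although it may miss a negative
   vector. *)
- move=> /(IH _ wF)[x [sx xF]]; exists (0 :: x); rewrite /= sx; split=> //.
  by rewrite expr0n /= !(mulr0, mul0r, add0r).
- set d := BinNums.Zpos p; have d0 : 0 < ZtoR d.
    by rewrite /ZtoR /= ltr0z; lia.
  move=> /(IH _ (wf_schur _ wF sm))[x [sx]]; rewrite size_schur sm minnn in sx.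
  rewrite eval_schur // => xF; exists (- dot (map ZtoR m) x / ZtoR d :: x).
  rewrite /= sx; split=> //; rewrite -(pmulr_rlt0 _ d0).
  move: xF; set a := dot _ _; set b := eval_form _ _ => xF.
  have -> : ZtoR d * (ZtoR d * (- a / ZtoR d) ^+ 2 + 2 * (- a / ZtoR d) * a + b) =
    ZtoR d * b - a ^+ 2 by field; rewrite gt_eqF.
  by [].
move=> _; exists (1 :: nseq (size F) 0); rewrite /= size_nseq; split=> //.
rewrite eval_form0 expr1n mulr1 addr0 (_ : dot _ _ = 0) ?mulr0 ?addr0.
  by rewrite /ZtoR /= ltrz0.
by elim: m (size F) {sm} => [|a m IHm] [|k] //=; rewrite mulr0 add0r.
Qed.

(* [101 / 50 >= lambda_star] and [43 / 50 <= rho ^ (-1/2)], with enough room for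
   every configuration below except the tree E6. *)
Definition zdiag (b : bool) : BinNums.Z := BinInt.Z.of_nat (if b then 58 else 101).
Definition zoff (a b : bool) : BinNums.Z :=
  BinInt.Z.sub (BinInt.Z.of_nat (if a then 50 else 0)) (BinInt.Z.of_nat (if b then 43 else 0)).

Fixpoint off_row (b : bool) (r k : seq bool) : seq BinNums.Z :=
  match r, k with a :: r', c :: k' => zoff a (b && c) :: off_row b r' k' | _, _ => [::] end.

Fixpoint bool_form (A : seq (seq bool)) (k : seq bool) : zform :=
  match A, k with
  | r :: A', b :: k' => (zdiag b, off_row b r k') :: bool_form A' k'
  | _, _ => [::]
  end.

Definition bdot (k : seq bool) (x : seq R) : R := dot [seq (b : bool)%:R | b <- k] x.

Fixpoint adj_form (l : R) (A : seq (seq bool)) (x : seq R) : R :=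
  match A, x with
  | r :: A', a :: x' => l * a ^+ 2 + 2 * a * bdot r x' + adj_form l A' x'
  | _, _ => 0
  end.

Fixpoint wf_adj (A : seq (seq bool)) : bool :=
  if A is r :: A' then (size r == size A') && wf_adj A' else true.

Lemma adj_form_le l m A x : l <= m -> adj_form l A x <= adj_form m A x.
Proof.
move=> lm; elim: A x => [|r A IH] [|a x] //=.
by rewrite lerD ?IH // lerD2r ler_wpM2r ?sqr_ge0.
Qed.

(** Scaling by 50 makes all coefficients integers; [58 = 101 - 43] is the diagonal entry at a
    neighbour of [p]. *)
Lemma eval_bool_form A k x : wf_adj A -> size k = size A ->
  eval_form (bool_form A k) x = 50 * adj_form (101 / 50) A x - 43 * bdot k x ^+ 2.
Proof.
elim: A k x => [|r A IH] [|b k] [|a x] //=; try by move=> *; rewrite /bdot /=; ring.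
move=> /andP[/eqP sr wA] [sk]; rewrite IH // /bdot /=.
have -> : dot (map ZtoR (off_row b r k)) x =
    50 * dot [seq (b : bool)%:R | b <- r] x - 43 * b%:R * dot [seq (b : bool)%:R | b <- k] x.
  elim: r k x {sr sk} (etrans sr (esym sk)) => [|c r IHr] [|g k] [|y x] //=; try by move=> *; ring.
  move=> [s]; rewrite IHr // /zoff ZtoRB !ZtoR_nat.
  by case: c; case: (b); case: g => /=; ring.
by rewrite /zdiag ZtoR_nat; case: b => /=; field.
Qed.

Lemma wf_bool_form A k : wf_adj A -> size k = size A ->
  wf_form (bool_form A k) /\ size (bool_form A k) = size A.
Proof.
elim: A k => [|r A IH] [|b k] //= /andP[/eqP sr wA] [sk].
have [w s] := IH k wA sk; rewrite w s andbT; split=> //; apply/eqP.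
by rewrite -sr; elim: r k {sr sk w s} (etrans sr (esym sk)) => [|c r IHr] [|g k] //= [/IHr ->].
Qed.

Lemma neg_pivot_adj_form n A k (l c : R) :
  wf_adj A -> size k = size A -> neg_pivot n (bool_form A k) ->
  l <= 101 / 50 -> 43 / 50 <= c ->
  exists x : seq R, size x = size A /\ adj_form l A x < c * bdot k x ^+ 2.
Proof.
move=> wA sk np ll cc; have [w s] := wf_bool_form wA sk.
have [x [sx xF]] := neg_pivotP w np; exists x; split; first by rewrite sx.
move: xF; rewrite eval_bool_form // => xF.
have := adj_form_le A x ll; have : 43 / 50 * bdot k x ^+ 2 <= c * bdot k x ^+ 2.
  by rewrite ler_wpM2r ?sqr_ge0.
lra.
Qed.

End Eval.

Section Restrict.
Context {R : realFieldType} {T : finType} (e : rel T) (es : symmetric e) (ei : irreflexive e).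

Fixpoint upper (s : seq T) : seq (seq bool) :=
  if s is u :: s' then map (e u) s' :: upper s' else [::].

Lemma wf_upper s : wf_adj (upper s) /\ size (upper s) = size s.
Proof. by elim: s => [|u s [w sz]] //=; rewrite size_map sz eqxx. Qed.

Fixpoint vec (s : seq T) (x : seq R) : T -> R :=
  match s, x with
  | u :: s', a :: x' => fun v => a * delta R u v + 1 * vec s' x' v
  | _, _ => fun=> 0
  end.

Lemma vec_out s x v : v \notin s -> vec s x v = 0.
Proof.
elim: s x => [|u s IH] [|a x] //=; rewrite inE negb_or => /andP[vu vs].
by rewrite IH // /delta (negPf vu) /=; ring.
Qed.

Lemma nbr_sum_vec s x p : nbr_sum e (vec s x) p = bdot (map (e p) s) x.
Proof.
have z0 : nbr_sum e (fun=> 0 : R) p = 0.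
  by rewrite /nbr_sum big1 // => v _; rewrite mulr0.
elim: s x => [|u s IH] [|a x] //=; rewrite ?z0 //.
by rewrite nbr_sum_lin IH nbr_sum_delta /bdot /=; ring.
Qed.

Lemma qform_vec l s x : uniq s -> size x = size s ->
  qform e l (vec s x) = adj_form l (upper s) x.
Proof.
elim: s x => [|u s IH] [|a x] //=.
  by move=> _ _; rewrite /qform /bform big1 // => v _; rewrite mul0r.
move=> /andP[us uq] [sx]; rewrite qform_lin // qform_delta // bform_delta nbr_sum_vec.
by rewrite vec_out // IH //; ring.
Qed.

Lemma sum_vec s x p :
  \sum_(v in [set v in s] | e p v) vec s x v = bdot (map (e p) s) x.
Proof.
rewrite -nbr_sum_vec /nbr_sum big_mkcond; apply: eq_bigr => v _; rewrite inE.
case: (boolP (v \in s)) => [_|vs]; last by rewrite vec_out // mulr0.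
by case: (e p v); rewrite ?mul1r ?mul0r.
Qed.

End Restrict.

(** * Exhaustive checks of the small configurations *)

Fixpoint all_bools (n : nat) (P : seq bool -> bool) : bool :=
  if n is n'.+1 then all_bools n' (fun s => P (true :: s)) && all_bools n' (fun s => P (false :: s))
  else P [::].

Lemma all_boolsP n P s : all_bools n P -> size s = n -> P s.
Proof.
elim: n P s => [|n IH] P [|b s] //= /andP[Pt Pf] [sz].
by case: b; [exact: IH (fun s => P (true :: s)) _ Pt sz
            | exact: IH (fun s => P (false :: s)) _ Pf sz].
Qed.

(* Vertices [c; x; y; z; u1; u2]: [c] is the centre of a claw on [x], [y], [z], the
   vertex [u1] separates [x] from [y] and [z], and [u2] separates [y] from [z].
   The bits [k] give the neighbours of the vertex [p] that starts the long path or
   the large clique.  The last two alternatives are E6 with [p] at the end of a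
   long arm. *)
Definition claw_check (s : seq bool) : bool :=
  match s with
  | [:: c1; ty; c2; x2; uu; k0; k1; k2; k3; k4; k5] =>
    let k := [:: k0; k1; k2; k3; k4; k5] in
    [|| ~~ has id k,
        neg_pivot 6 (bool_form [:: [:: true; true; true; c1; c2]; [:: false; false; ty; x2];
          [:: false; ~~ ty; true]; [:: ~~ ty; false]; [:: uu]; [::]] k),
        ([:: c1; ty; c2; x2; uu] == [:: false; true; false; false; false]) &&
          (k == [:: false; false; false; false; true; false]) |
        ([:: c1; ty; c2; x2; uu] == [:: false; true; false; false; false]) &&
          (k == [:: false; false; false; false; false; true])]
  | _ => true
  end.

Lemma claw_checkT : all_bools 11 claw_check.
Proof. by vm_compute. Qed.

(* Vertices [u; w; v; y; z; z']: the triangles [u w v] and [u w y] share an edge,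
   [z] makes the first one odd, [z'] separates [v] from [y]; when [z] separates
   them too, [z'] makes the second triangle odd. *)
Definition diamond_check (s : seq bool) : bool :=
  match s with
  | [:: zu; zw; zv; zy; z'u; z'w; z'v; zz; k0; k1; k2; k3; k4; k5] =>
    let k := [:: k0; k1; k2; k3; k4; k5] in
    [|| ~~ has id k, ~~ (zu (+) zw (+) zv), 
        ~~ (if zv == zy then z'v else z'u (+) z'w (+) ~~ z'v) |
        neg_pivot 6 (bool_form [:: [:: true; true; true; zu; z'u]; [:: true; true; zw; z'w];
          [:: false; zv; z'v]; [:: zy; ~~ z'v]; [:: zz]; [::]] k)]
  | _ => true
  end.

Lemma diamond_checkT : all_bools 14 diamond_check.
Proof. by vm_compute. Qed.

(* Three twins [x], [y], [z] and a common neighbour; as twins they have the same bit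
   in [k]. *)
Definition triple_check (s : seq bool) : bool :=
  match s with
  | [:: k0; k1] =>
    ~~ (k0 || k1) || neg_pivot 4 (bool_form [:: [:: true; true; true]; [:: false; false];
      [:: false]; [::]] [:: k0; k1; k1; k1])
  | _ => true
  end.

Lemma triple_checkT : all_bools 2 triple_check.
Proof. by vm_compute. Qed.

(* Twins [u], [u'] with nonadjacent neighbours [v], [y] separated by [z]. *)
Definition nbr_check (s : seq bool) : bool :=
  match s with
  | [:: uz; k0; k2; k3; k4] =>
    ~~ [|| k0, k2, k3 | k4] || neg_pivot 5 (bool_form [:: [:: false; true; true; uz];
      [:: true; true; uz]; [:: false; true]; [:: false]; [::]] [:: k0; k0; k2; k3; k4])
  | _ => true
  end.

Lemma nbr_checkT : all_bools 5 nbr_check.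
Proof. by vm_compute. Qed.

(* Twins [u], [u'] with adjacent neighbours [v], [y]; the triangle [u v y] being
   even restricts [k]. *)
Definition even_check (s : seq bool) : bool :=
  match s with
  | [:: k0; k2; k3] =>
    [|| ~~ [|| k0, k2 | k3], k0 (+) k2 (+) k3 |
      neg_pivot 4 (bool_form [:: [:: false; true; true];
      [:: true; true]; [:: true]; [::]] [:: k0; k0; k2; k3])]
  | _ => true
  end.

Lemma even_checkT : all_bools 3 even_check.
Proof. by vm_compute. Qed.

(** The checks presuppose distinct vertices; distinctness is read off from separation or from
    parity. *)
Lemma sep_neq (T : eqType) (e : T -> T -> bool) a b p q : e a p = e a q -> e b p != e b q -> a != b.
Proof. by move=> ap; apply: contraNneq => <-; apply/eqP. Qed.

Lemma odd_neq (T : eqType) (e : T -> T -> bool) a b p q r :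
  e a p (+) e a q (+) e a r = false -> e b p (+) e b q (+) e b r -> a != b.
Proof. by move=> ap; apply: contraTneq => <-; rewrite ap. Qed.

(** * Large graphs avoid the configurations *)

Section LargeGraph.
Context {R : realFieldType} {T : finType} (e : rel T) (s l : R).
Context (es : symmetric e) (ei : irreflexive e).
Context (s43 : 43 / 50 <= s^-1) (l101 : l <= 101 / 50).
Context (s0 : 0 < s) (s6 : s ^+ 6 = s ^+ 2 + 1) (ls : l < s ^+ 5).
Context (heavy : forall F : {set T}, F != set0 -> (#|F| <= 6)%N ->
  exists p, (exists2 f, f \in F & e p f) /\
    forall x : T -> R, (forall u, u \notin F -> x u = 0) ->
      s^-1 * (\sum_(u in F | e p u) x u) ^+ 2 <= qform e l x).

Lemma heavy_seq (r : seq T) : uniq r -> (0 < size r <= 6)%N ->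
  exists p, has id (map (e p) r) /\
    forall x : seq R, size x = size r ->
      s^-1 * bdot (map (e p) r) x ^+ 2 <= adj_form l (upper e r) x.
Proof.
move=> ur /andP[r0 r6]; have [||p [[f fr pf] H]] := heavy (F := [set v in r]).
- by case: r r0 {ur r6} => // v r _; apply/set0Pn; exists v; rewrite inE mem_head.
- by rewrite cardsE (card_uniqP ur).
exists p; split; first by rewrite has_map; apply/hasP; exists f => //; rewrite inE in fr.
move=> x sx; rewrite -qform_vec // -sum_vec; apply: H => u ur'.
by rewrite vec_out //; rewrite inE in ur'.
Qed.

Lemma no_negative_pivot (r : seq T) p :
  (forall x : seq R, size x = size r ->
      s^-1 * bdot (map (e p) r) x ^+ 2 <= adj_form l (upper e r) x) ->
  neg_pivot (size r) (bool_form (upper e r) (map (e p) r)) = false.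
Proof.
move=> H; apply/negP => np; have [wA sA] := wf_upper e r.
have [|x [sx]] := neg_pivot_adj_form wA _ np l101 s43; first by rewrite size_map.
by rewrite ltNge H // sx.
Qed.

(* At [lambda_star = s^5] the tree E6 with an infinite path attached to the end
   of a long arm has the null vector below on its six vertices. *)
Lemma E6_form_lt (x : seq R) (k : seq bool) :
  (k = [:: false; false; false; false; true; false] /\
   x = [:: s ^+ 8; - s ^+ 7; - s ^+ 5; - s ^+ 3; s ^+ 6; 1]) \/
  (k = [:: false; false; false; false; false; true] /\
   x = [:: s ^+ 8; - s ^+ 5; - s ^+ 7; - s ^+ 3; 1; s ^+ 6]) ->
  adj_form l [:: [:: true; true; true; false; false]; [:: false; false; true; false];
    [:: false; false; true]; [:: false; false]; [:: false]; [::]] x <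
  s^-1 * bdot k x ^+ 2.
Proof.
(* [N] is the squared norm of [x], so passing from [s^5] to [l] lowers the form strictly. In [x] the
   long arm decays with ratio [1/s], and the leaves fix the other entries. *)
move=> kx; pose N : R := s ^+ 16 + s ^+ 14 + s ^+ 10 + s ^+ 6 + s ^+ 12 + 1.
have N0 : 0 < N by rewrite /N; do ?apply: addr_gt0; rewrite ?exprn_gt0.
have lN : l * N < s ^+ 5 * N by rewrite ltr_pM2r.
have sN : s ^+ 5 * N - 2 * s ^+ 15 - 2 * s ^+ 13 - 2 * s ^+ 11 - 2 * s ^+ 13 - 2 * s ^+ 5
   = s^-1 * (s ^+ 6) ^+ 2.
  have -> : s^-1 * (s ^+ 6) ^+ 2 = s ^+ 11 by field; rewrite gt_eqF.
  apply/eqP; rewrite -subr_eq0 /N; apply/eqP.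
  transitivity ((s ^+ 6 - (s ^+ 2 + 1)) *
    (s ^+ 15 + s ^+ 13 + 2 * s ^+ 11 + s ^+ 9 - s ^+ 7 + s ^+ 5)); first by ring.
  by rewrite s6 subrr mul0r.
case: kx => [][-> ->]; rewrite /= /bdot /=;
  set b := (X in _ < s^-1 * X ^+ 2); have -> : b = s ^+ 6 by rewrite /b; ring.
  by rewrite -sN /N; move: lN; rewrite /N; lra.
by rewrite -sN /N; move: lN; rewrite /N; lra.
Qed.

Lemma no_claw c x y z u1 u2 :
  e c x -> e c y -> e c z -> ~~ e x y -> ~~ e x z -> ~~ e y z ->
  e u1 x != e u1 y -> e u1 y = e u1 z -> e u2 y -> ~~ e u2 z -> False.
Proof.
move=> cx cy cz /negbTE xy /negbTE xz /negbTE yz u1xy u1yz u2y u2z.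
have neq a b : e a b -> a != b by apply: contraTneq => ->; rewrite ei.
have u1xz : e u1 x != e u1 z by rewrite -u1yz.
have u2yz : e u2 y != e u2 z by rewrite u2y (negbTE u2z).
have [yx zx zy] : [/\ e y x = false, e z x = false & e z y = false] by rewrite !(es y) !(es z).
pose r := [:: c; x; y; z; u1; u2].
have ur : uniq r.
  rewrite /r /= !inE !negb_or (neq _ _ cx) (neq _ _ cy) (neq _ _ cz) /=.
  have -> : c != u1 by apply: (sep_neq (e := e) (p := x) (q := y)); rewrite ?cx ?cy.
  have -> : c != u2 by apply: (sep_neq (e := e) (p := y) (q := z)); rewrite ?cz ?cy.
  have -> : x != y by apply: contra_neq u1xy => ->.
  have -> : x != z by apply: contra_neq u1xz => ->.
  have -> : y != z by apply: contra_neq u2yz => ->.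
  have -> : x != u1 by apply: (sep_neq (e := e) (p := x) (q := y)); rewrite ?ei ?xy.
  have -> : y != u1 by apply: (sep_neq (e := e) (p := x) (q := y)); rewrite ?ei ?yx.
  have -> : z != u1 by apply: (sep_neq (e := e) (p := x) (q := z)); rewrite ?ei ?zx.
  have -> : x != u2 by apply: (sep_neq (e := e) (p := y) (q := z)); rewrite ?xy ?xz.
  have -> : y != u2 by apply: (sep_neq (e := e) (p := y) (q := z)); rewrite ?ei ?yz.
  have -> : z != u2 by apply: (sep_neq (e := e) (p := y) (q := z)); rewrite ?ei ?zy.
  by have -> : u1 != u2 by apply: (sep_neq (e := e) (p := y) (q := z)); rewrite ?u1yz.
have [p [hp H]] := heavy_seq ur isT; have np := no_negative_pivot H.
have up : upper e r = [:: [:: true; true; true; e c u1; e c u2];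
    [:: false; false; e x u1; e x u2]; [:: false; ~~ e x u1; true];
    [:: ~~ e x u1; false]; [:: e u1 u2]; [::]].
  rewrite /= cx cy cz xy xz yz (es y u2) u2y (es z u2) (negbTE u2z).
  have yu : e y u1 = ~~ e x u1 by rewrite !(es _ u1); move: u1xy; case: (e u1 x); case: (e u1 y).
  by rewrite yu (es z) -u1yz (es u1) yu.
have := all_boolsP claw_checkT (s := [:: e c u1; e x u1; e c u2; e x u2; e u1 u2;
   e p c; e p x; e p y; e p z; e p u1; e p u2]) erefl.
rewrite up in np H; rewrite /claw_check -[[:: e p c; _; _; _; _; _]]/(map (e p) r) hp np /=.
case/orP => /andP[/eqP[E1 E2 E3 E4 E5] /eqP Ek].
- have := H [:: s ^+ 8; - s ^+ 7; - s ^+ 5; - s ^+ 3; s ^+ 6; 1] erefl.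
  by rewrite E1 E2 E3 E4 E5 leNgt E6_form_lt //; left.
- have := H [:: s ^+ 8; - s ^+ 5; - s ^+ 7; - s ^+ 3; 1; s ^+ 6] erefl.
  by rewrite E1 E2 E3 E4 E5 leNgt E6_form_lt //; right.
Qed.

(** A vertex separating [x] from [y] isolates one of them from the other two leaves; it serves as
    [u1], and a vertex separating the remaining two leaves as [u2]. *)
Lemma claw_twin c x y z : e c x -> e c y -> e c z -> ~~ e x y -> ~~ e x z -> ~~ e y z ->
  [|| twin e x y, twin e x z | twin e y z].
Proof.
move=> cx cy cz xy xz yz; apply/negPn/negP; rewrite !negb_or.
case/and3P => /forallPn[a xya] /forallPn[b xzb] /forallPn[d yzd].
have core x' y' z' u1 u2 : e c x' -> e c y' -> e c z' -> ~~ e x' y' -> ~~ e x' z' -> ~~ e y' z' ->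
    e x' u1 != e y' u1 -> e y' u1 = e z' u1 -> e y' u2 != e z' u2 -> False.
  move=> cx' cy' cz' xy' xz' yz'; rewrite !(es _ u1) !(es _ u2) => h1 h2 h3.
  case: (boolP (e u2 y')) h3 => [y2 z2|y2 z2].
    by apply: (no_claw cx' cy' cz' xy' xz' yz' h1 h2 y2); move: z2; case: (e u2 z').
  have zy' : ~~ e z' y' by rewrite es.
  apply: (no_claw (u1 := u1) (u2 := u2) cx' cz' cy' xz' xy' zy') => //; rewrite -?h2 //.
  by move: z2; case: (e u2 z').
have [yx zx zy] : [/\ ~~ e y x, ~~ e z x & ~~ e z y] by rewrite !(es y x) !(es z).
have [yza|yza] := eqVneq (e y a) (e z a); first exact: (core x y z a d).
have xza : e x a = e z a by move: xya yza; case: (e x a); case: (e y a); case: (e z a).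
by apply: (core y x z a b); rewrite // eq_sym.
Qed.

Lemma no_diamond u w v y z z' : e u w -> e u v -> e w v -> e u y -> e w y -> ~~ e v y ->
  e z u (+) e z w (+) e z v -> e z' v != e z' y ->
  (if e z v == e z y then e z' v else e z' u (+) e z' w (+) e z' y) -> False.
Proof.
move=> uw uv wv uy wy /negbTE vy oz dz cond.
have neq a b : e a b -> a != b by apply: contraTneq => ->; rewrite ei.
have [wu [vu vw]] : e w u = true /\ e v u = true /\ e v w = true by rewrite (es w) (es v u) (es v w).
have [yu [yw yv]] : e y u = true /\ e y w = true /\ e y v = false by rewrite !(es y).
have z'y : e z' y = ~~ e z' v by move: dz; case: (e z' y); case: (e z' v).
pose r := [:: u; w; v; y; z; z'].
have ur : uniq r.
  rewrite /r /= !inE !negb_or (neq _ _ uw) (neq _ _ uv) (neq _ _ uy) (neq _ _ wv) (neq _ _ wy) /=.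
  have -> : v != y by apply: contra_neq dz => ->.
  have -> : u != z by apply: (odd_neq (e := e) _ oz); rewrite ei uw uv.
  have -> : w != z by apply: (odd_neq (e := e) _ oz); rewrite ei wu wv.
  have -> : v != z by apply: (odd_neq (e := e) _ oz); rewrite ei vu vw.
  have -> : y != z by apply: (odd_neq (e := e) _ oz); rewrite yu yw yv.
  have -> : u != z' by apply: (sep_neq (e := e) (p := v) (q := y)); rewrite ?uv ?uy.
  have -> : w != z' by apply: (sep_neq (e := e) (p := v) (q := y)); rewrite ?wv ?wy.
  have -> : v != z' by apply: (sep_neq (e := e) (p := v) (q := y)); rewrite ?ei ?vy.
  have -> : y != z' by apply: (sep_neq (e := e) (p := v) (q := y)); rewrite ?ei ?yv.
  suff -> : z != z' by [].
  move: cond; case: eqVneq => [zz _|zz cond]; first exact: (sep_neq (e := e) zz dz).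
  rewrite eq_sym; apply: (odd_neq (e := e) _ oz).
  by move: cond; rewrite z'y; case: (e z' u); case: (e z' w); case: (e z' v).
have [p [hp H]] := heavy_seq ur isT; have np := no_negative_pivot H.
have up : upper e r = [:: [:: true; true; true; e z u; e z' u]; [:: true; true; e z w; e z' w];
          [:: false; e z v; e z' v]; [:: e z y; ~~ e z' v]; [:: e z z']; [::]].
  by rewrite /= uw uv uy wv wy vy !(es _ z) !(es _ z') (es z' z) z'y.
have := all_boolsP diamond_checkT (s := [:: e z u; e z w; e z v; e z y; e z' u; e z' w; e z' v;
  e z z'; e p u; e p w; e p v; e p y; e p z; e p z']) erefl.
rewrite up in np; rewrite /diamond_check -[[:: e p u; _; _; _; _; _]]/(map (e p) r) hp np oz /=.
by rewrite -z'y cond.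
Qed.

(** If a witness of oddness does not separate [v] from [y], it makes both triangles odd, and
    exchanging [v] and [y] lets any separating vertex see the apex required. If both witnesses
    separate, the second one is the separating vertex. *)
Lemma diamond_twin u w v y : e u w -> e u v -> e w v -> e u y -> e w y ->
  odd3 e u w v -> odd3 e u w y -> e v y || twin e v y.
Proof.
move=> uw uv wv uy wy /existsP[z oz] /existsP[z' oz']; apply/orP.
case: (boolP (e v y)) => [|vy]; [by left | right].
rewrite -[twin e v y]negbK; apply/negP => /forallPn[t vyt].
rewrite !(es _ t) in vyt; have yv : ~~ e y v by rewrite es.
have flat a : e a u (+) e a w (+) e a v -> e a v = e a y -> False.
  move=> oa av; case: (boolP (e t v)) => tv.
    by apply: (no_diamond uw uv wv uy wy vy oa vyt); rewrite av eqxx.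
  apply: (no_diamond uw uy wy uv wv yv (z := a) (z' := t)).
  - by rewrite -av.
  - by rewrite eq_sym.
  - by rewrite av eqxx; move: vyt tv; case: (e t v); case: (e t y).
have [zE|zN] := eqVneq (e z v) (e z y); first exact: flat oz zE.
have [z'E|z'N] := eqVneq (e z' v) (e z' y); first by apply: (flat z'); rewrite // z'E.
by apply: (no_diamond uw uv wv uy wy vy oz z'N); rewrite (negPf zN).
Qed.

Lemma no_triple c x y z : e c x -> twin e x y -> twin e x z -> x != y -> x != z -> y = z.
Proof.
move=> cx txy txz xy xz; apply/eqP/negP => /negP yz.
have neq a b : e a b -> a != b by apply: contraTneq => ->; rewrite ei.
have exy w : e w x = e w y by rewrite !(es w) (twinE w txy).
have exz w : e w x = e w z by rewrite !(es w) (twinE w txz).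
pose r := [:: c; x; y; z].
have [cy cz] : e c y /\ e c z by rewrite -exy -exz.
have ur : uniq r.
  by rewrite /r /= !inE !negb_or (neq _ _ cx) (neq _ _ cy) (neq _ _ cz) xy xz yz.
have [p [hp H]] := heavy_seq ur isT; have np := no_negative_pivot H.
have up : upper e r = [:: [:: true; true; true]; [:: false; false]; [:: false]; [::]].
  have [xy0 xz0] : e x y = false /\ e x z = false by rewrite -exy -exz ei.
  by rewrite /= cx cy cz -(exz y) (es y x) xy0 xz0.
have := all_boolsP triple_checkT (s := [:: e p c; e p x]) erefl.
rewrite up in np; move: hp np; rewrite /r /= -exy -exz orbF !orbb => hp np.
by rewrite hp np.
Qed.

Lemma twin_nbr u u' v y : twin e u u' -> u != u' -> e u v -> e u y -> e v y || twin e v y.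
Proof.
move=> tu uu' uv uy; apply/orP; case: (boolP (e v y)) => [|vy]; [by left | right].
have euu w : e u w = e u' w := twinE w tu.
have core v' y' z : e u v' -> e u y' -> ~~ e v' y' -> e v' z -> ~~ e y' z -> False.
  move=> uv' uy' /negbTE vy' vz /negbTE yz.
  have neq a b : e a b -> a != b by apply: contraTneq => ->; rewrite ei.
  have zv : e z v' by rewrite es.
  have dz : e z v' != e z y' by rewrite zv (es z) yz.
  have yv' : e y' v' = false by rewrite es.
  pose r := [:: u; u'; v'; y'; z].
  have ur : uniq r.
    rewrite /r /= !inE !negb_or uu' (neq _ _ uv') (neq _ _ uy') (neq _ _ vz).
    rewrite (neq u' v') -?euu // (neq u' y') -?euu //=.
    have -> : v' != y' by apply: contra_neq dz => ->.
    have -> : u != z by apply: (sep_neq (e := e) _ dz); rewrite uv' uy'.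
    have -> : u' != z by apply: (sep_neq (e := e) _ dz); rewrite -!euu uv' uy'.
    by have -> : y' != z by apply: (sep_neq (e := e) _ dz); rewrite ei yv'.
  have [p [hp H]] := heavy_seq ur isT; have np := no_negative_pivot H.
  have up : upper e r = [:: [:: false; true; true; e u z]; [:: true; true; e u z];
      [:: false; true]; [:: false]; [::]].
    by rewrite /= -!euu uv' uy' vy' vz yz (es u) -euu ei.
  have := all_boolsP nbr_checkT (s := [:: e u z; e p u; e p v'; e p y'; e p z]) erefl.
  have pu : e p u' = e p u by rewrite !(es p) euu.
  rewrite up in np; move: hp np; rewrite /r /= pu orbF => hp np.
  by rewrite /nbr_check np orbF; move: hp; clear; case: (e p u) => //= ->.
rewrite -[twin e v y]negbK; apply/negP => /forallPn[t vyt].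
case: (boolP (e v t)) vyt => vt; rewrite ?negbK => yt.
  by apply: (core v y t uv uy vy vt); move: yt; case: (e y t).
have yv : ~~ e y v by rewrite es.
by apply: (core y v t uy uv yv _ vt); move: yt; case: (e y t).
Qed.

Lemma twin_triangle_odd u u' v y : twin e u u' -> u != u' -> e u v -> e u y -> e v y ->
  odd3 e u v y.
Proof.
move=> tu uu' uv uy vy; rewrite -[odd3 _ _ _ _]negbK; apply/negP => /existsPn even.
have euu w : e u w = e u' w := twinE w tu.
have neq a b : e a b -> a != b by apply: contraTneq => ->; rewrite ei.
pose r := [:: u; u'; v; y].
have [u'v u'y] : e u' v /\ e u' y by rewrite -!euu.
have ur : uniq r.
  by rewrite /r /= !inE !negb_or uu' (neq _ _ uv) (neq _ _ uy) (neq _ _ u'v) (neq _ _ u'y) (neq _ _ vy).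
have [p [hp H]] := heavy_seq ur isT; have np := no_negative_pivot H.
have up : upper e r = [:: [:: false; true; true]; [:: true; true]; [:: true]; [::]].
  by rewrite /= -!euu uv uy vy (es u) -euu ei.
have := all_boolsP even_checkT (s := [:: e p u; e p v; e p y]) erefl.
have pu : e p u' = e p u by rewrite !(es p) euu.
rewrite up in np; move: hp np; rewrite /r /= pu orbF => hp np.
by rewrite /even_check np (negPf (even p)) /= orbF; move: hp; clear; case: (e p u) => //= ->.
Qed.

Lemma large_psd2 : connected_rel e -> psd e (2 : R).
Proof.
move=> ec; apply: psd2_of_local => //.
- move=> x y z txy txz xy xz; have [c|N] := pickP (fun c => e c x).
    by move=> cx; apply: (no_triple cx txy txz).
  have D : [set x] = setT.
    apply: ec => [|u v]; first by apply/set0Pn; exists x; rewrite inE.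
    by rewrite inE => /eqP ->; rewrite es N.
  have : y \in [set x] by rewrite D inE.
  by rewrite inE eq_sym (negPf xy).
- exact: claw_twin.
- exact: diamond_twin.
- exact: twin_nbr.
- exact: twin_triangle_odd.
Qed.

End LargeGraph.

(** * Components and spectra *)

Definition kernel_vector (R : realFieldType) (T : finType) (e : rel T) (l : R) : Prop :=
  exists x : T -> R, (exists u, x u != 0) /\ forall u, l * x u + nbr_sum e x u = 0.

(* [- l] is the smallest eigenvalue. *)
Definition bottom_at (R : realFieldType) (T : finType) (e : rel T) (l : R) : Prop :=
  psd e l /\ kernel_vector e l.

Section Component.
Context {R : realFieldType} {T : finType} (e : rel T) (es : symmetric e) (ei : irreflexive e).

(** Ordinals instead of a subtype: relations on ['I_n] with [n] bounded form a finite family,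
    whatever the original vertex type. *)
Definition induced_rel (C : {set T}) : rel 'I_#|C| :=
  fun i j => e (enum_val i) (enum_val j).

Arguments induced_rel C i j : clear implicits.

Lemma sum_induced (C : {set T}) (f : T -> R) : (forall u, u \notin C -> f u = 0) ->
  \sum_u f u = \sum_(i < #|C|) f (enum_val i).
Proof.
move=> f0; rewrite -(big_enum_val (A := mem C) f) [RHS]big_mkcond; apply: eq_bigr => u _.
by case: ifP => // /negbT /f0.
Qed.

Lemma psd_induced (C : {set T}) (l : R) : psd e l -> psd (induced_rel C) l.
Proof.
move=> P x; have [C0|/set0Pn[u0 u0C]] := eqVneq C set0.
  by rewrite /qform /bform big1 // => i _; have := enum_valP i; rewrite {2}C0 inE.
pose y u : R := (u \in C)%:R * x (enum_rank_in u0C u).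
have y0 u : u \notin C -> y u = 0 by move=> /negPf uC; rewrite /y uC mul0r.
have yx i : y (enum_val i) = x i by rewrite /y enum_valP mul1r enum_valK_in.
have -> : qform (induced_rel C) l x = qform e l y; last exact: P.
rewrite /qform /bform [RHS](@sum_induced C) => [|u /y0 ->]; last by rewrite mul0r.
apply: eq_bigr => i _; rewrite yx; congr (_ * (_ + _)); rewrite /nbr_sum.
rewrite [RHS](@sum_induced C) => [|u /y0 ->]; last by rewrite mulr0.
by apply: eq_bigr => j _; rewrite yx.
Qed.

(** The component of a vertex where the kernel vector is nonzero carries a kernel vector by
    restriction. *)
Lemma exists_component (l : R) : bottom_at e l ->
  exists C : {set T}, bottom_at (induced_rel C) l /\ connected_rel (induced_rel C).
Proof.
move=> [P [x [[u0 xu0] K]]]; pose C := [set v | connect e u0 v].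
have u0C : u0 \in C by rewrite inE connect0.
have Ccl u v : u \in C -> e u v -> v \in C.
  by rewrite !inE => u0u uv; apply: connect_trans u0u (connect1 uv).
exists C; split.
  split; first exact: psd_induced.
  exists (fun i => x (enum_val i)); split.
    by exists (enum_rank_in u0C u0); rewrite enum_rankK_in.
  move=> i; rewrite -[RHS](K (enum_val i)); congr (_ + _); rewrite /nbr_sum.
  rewrite [RHS](@sum_induced C) // => v vC.
  suff -> : e (enum_val i) v = false by rewrite mul0r.
  by apply: contraNF vC; apply: Ccl (enum_valP i).
move=> D /set0Pn[i iD] Dcl; apply/setP => j; rewrite inE.
have csym := sym_connect_sym es.
have /connectP[p pp pE] : connect e (enum_val i) (enum_val j).
  have := enum_valP i; have := enum_valP j; rewrite !inE => u0j u0i.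
  by apply: connect_trans u0j; rewrite csym.
elim: p i iD pp pE => [|v p IH] i iD /=; first by move=> _ /enum_val_inj ->.
move=> /andP[iv pp] pE; have vC : v \in C by apply: Ccl iv; apply: enum_valP.
have vE : enum_val (enum_rank_in u0C v) = v by rewrite enum_rankK_in.
apply: (IH (enum_rank_in u0C v)); rewrite ?vE //.
by apply: Dcl iD _; rewrite /induced_rel vE.
Qed.

End Component.

Arguments induced_rel {T} e C i j.

(* Imported only now because they shadow the names of finite set theory. *)
From mathcomp Require Import all_classical all_reals all_analysis.
Import numFieldNormedType.Exports.
Local Open Scope classical_set_scope.
Local Open Scope ring_scope.

(** * Smallest eigenvalues as the boundary of positivity *)

Section Spectrum.
Context {R : realType}.

Lemma kernel_qform (T : finType) (e : rel T) (l : R) (x : T -> R) :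
  (forall u, l * x u + nbr_sum e x u = 0) -> qform e l x = 0.
Proof. by move=> K; rewrite /qform /bform big1 // => u _; rewrite K mulr0. Qed.

Lemma bottom_unique (T : finType) (e : rel T) (l m : R) :
  bottom_at e l -> bottom_at e m -> l = m.
Proof.
wlog lm : l m / l <= m.
  by move=> H lb mb; case: (leP l m) => [lm|/ltW ml]; [|symmetry]; apply: H.
move=> [lP _] [_ [x [[u xu] /kernel_qform q0]]]; apply/eqP; rewrite eq_le lm /=.
by rewrite leNgt; apply/negP => /(qform_lt e xu); rewrite q0 ltNge lP.
Qed.

Lemma psd_sqr_bform (T : finType) (e : rel T) (l : R) (x y : T -> R) :
  symmetric e -> psd e l ->
  bform e l x y ^+ 2 <= qform e l x * qform e l y.
Proof.
move=> es P; have Q a b := P (fun v => a * x v + b * y v).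
have {}Q a b : 0 <= a ^+ 2 * qform e l x + 2 * a * b * bform e l x y + b ^+ 2 * qform e l y.
  by rewrite -qform_lin.
have p0 := P x; have p1 := P y; move: Q p0 p1.
move: (bform e l x y) (qform e l x) (qform e l y) => b p q Q p0 p1.
have [q0|qn0] := eqVneq q 0; last first.
  have qp : 0 < q by rewrite lt_def qn0.
  have := Q q (- b); have -> : q ^+ 2 * p + 2 * q * - b * b + (- b) ^+ 2 * q = q * (p * q - b ^+ 2).
    by ring.
  by rewrite pmulr_rge0 // subr_ge0.
rewrite q0 mulr0; have := Q (- b) (p + 1); rewrite q0.
have -> : (- b) ^+ 2 * p + 2 * - b * (p + 1) * b + (p + 1) ^+ 2 * 0 = - (b ^+ 2 * (p + 2)) by ring.
by rewrite oppr_ge0 pmulr_lle0 //; lra.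
Qed.

Definition rowof (T : finType) (x : T -> R) : 'rV[R]_#|T| := \row_i x (enum_val i).
Definition funof (T : finType) (v : 'rV[R]_#|T|) : T -> R := fun u => v 0 (enum_rank u).

Lemma rowofK (T : finType) (v : 'rV[R]_#|T|) : rowof (funof v) = v.
Proof. by apply/rowP => i; rewrite mxE /funof enum_valK. Qed.

Lemma sum_enum (T : finType) (f : T -> R) : \sum_u f u = \sum_(i < #|T|) f (enum_val i).
Proof. by rewrite (reindex (@enum_val T predT)) //=; apply: onW_bij; exact: enum_val_bij. Qed.

Definition relmx (T : finType) (e : rel T) : 'M[R]_#|T| :=
  \matrix_(i, j) (e (enum_val i) (enum_val j))%:R.

Lemma rowof_mul (T : finType) (e : rel T) (x : T -> R) j : symmetric e ->
  (rowof x *m relmx e) 0 j = nbr_sum e x (enum_val j).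
Proof.
move=> es; rewrite !mxE /nbr_sum [RHS]sum_enum; apply: eq_bigr => i _.
by rewrite !mxE es mulrC.
Qed.

Lemma psd_card (T : finType) (e : rel T) : symmetric e -> psd e (#|T|%:R : R).
Proof.
move=> es x; rewrite /qform /bform.
have -> : \sum_u x u * (#|T|%:R * x u + nbr_sum e x u) =
          \sum_u \sum_v (x u ^+ 2 + (e u v)%:R * x u * x v).
  apply: eq_bigr => u _; rewrite big_split /= sumr_const -mulr_natl mulrDr.
  congr (_ + _); first by ring.
  by rewrite /nbr_sum mulr_sumr; apply: eq_bigr => v _; ring.
set S := \sum_u _; suff : 0 <= S + S by lra.
rewrite {2}/S exchange_big -big_split sumr_ge0 //= => u _.
rewrite -big_split sumr_ge0 //= => v _; rewrite (es v u).
case: (e u v) => /=; last by have := sqr_ge0 (x u); have := sqr_ge0 (x v); lra.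
by have := sqr_ge0 (x u + x v); lra.
Qed.

Lemma psd_ge0 (T : finType) (e : rel T) (u : T) (l : R) :
  irreflexive e -> psd e l -> 0 <= l.
Proof. by move=> ei /(_ (delta R u)); rewrite qform_delta. Qed.

Lemma ler_norm_sum_sqr (T : finType) (x : T -> R) u v :
  `|x u| * `|x v| <= \sum_w x w ^+ 2.
Proof.
have sq w : `|x w| ^+ 2 <= \sum_w x w ^+ 2.
  rewrite (bigD1 w) //= real_normK ?num_real // lerDl.
  by apply: sumr_ge0 => ? _; apply: sqr_ge0.
by have := sq u; have := sq v; have := sqr_ge0 (`|x u| - `|x v|); lra.
Qed.

(** [m] is the least value with a semidefinite form. If [A + m] were invertible, Cauchy-Schwarz for
    [x] and [y = (A + m)^-1 x] would give [N^2 <= q(x) K N], with [N] the squared norm of [x] and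
    [q] the form at [m]; the form would then still be semidefinite at [m - 1/(K + 1)]. *)
Lemma exists_bottom (T : finType) (e : rel T) (u : T) :
  symmetric e -> irreflexive e -> exists l : R, bottom_at e l.
Proof.
move=> es ei; pose S := [set l : R | psd e l].
have S0 : S !=set0 by exists #|T|%:R; apply: psd_card.
have Slb : has_lbound S by exists 0 => l; apply: psd_ge0 u l ei.
have Si : has_inf S by [].
pose m := inf S.
have mP : psd e m.
  move=> x; rewrite leNgt; apply/negP => qx.
  pose N := \sum_u x u ^+ 2; have N0 : 0 <= N by apply: sumr_ge0 => ? _; apply: sqr_ge0.
  have d0 : 0 < - qform e m x / (N + 1) by rewrite divr_gt0 // ?oppr_gt0 //; lra.
  have [l lS lm] := inf_adherent d0 Si.
  have := lS x; rewrite leNgt => /negP; apply.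
  apply: le_lt_trans (qform_le e x (ltW lm)) _; rewrite qform_shift -/m -/N.
  have -> : qform e m x + - qform e m x / (N + 1) * N = qform e m x / (N + 1).
    by field; rewrite gt_eqF //; lra.
  by rewrite pmulr_llt0 // invr_gt0; lra.
exists m; split=> //; apply: contrapT => nk.
pose M := m%:M + relmx e.
have rowM x j : (rowof x *m M) 0 j = m * x (enum_val j) + nbr_sum e x (enum_val j).
  by rewrite mulmxDr mul_mx_scalar mxE rowof_mul // !mxE.
have uM : M \in unitmx.
  rewrite unitmxE unitfE; apply/negP => /det0P[v v0 vM]; apply: nk.
  exists (funof v); split.
    have /rV0Pn[i vi] := v0; by exists (enum_val i); rewrite /funof enum_valK.
  by move=> w; have := rowM (funof v) (enum_rank w); rewrite rowofK vM mxE enum_rankK => <-.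
pose K := \sum_u \sum_v `|invmx M (enum_rank v) (enum_rank u)|.
have K0 : 0 <= K by do 2!apply: sumr_ge0 => ? _.
suff : psd e (m - (K + 1)^-1).
  move=> /(ge_inf Slb); rewrite -/m.
  have : 0 < (K + 1)^-1 by rewrite invr_gt0; lra.
  lra.
move=> x; rewrite qform_shift; set N := \sum_u _.
pose y := funof (rowof x *m invmx M).
have yx w : m * y w + nbr_sum e y w = x w.
  by rewrite -[w]enum_rankK -rowM rowofK mulmxKV // mxE.
have N0 : 0 <= N by apply: sumr_ge0 => ? _; apply: sqr_ge0.
have := psd_sqr_bform x y es mP.
have -> : bform e m x y = N by apply: eq_bigr => w _; rewrite yx.
have yK : qform e m y <= K * N.
  rewrite /qform /bform; under eq_bigr do rewrite yx.
  rewrite /K mulr_suml; apply: ler_sum => w _.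
  rewrite {1}/y /funof mxE mulr_suml [X in _ <= X * _]sum_enum [X in _ <= X]mulr_suml; apply: ler_sum => i _.
  rewrite mxE enum_valK; apply: le_trans (ler_norm _) _.
  rewrite !normrM mulrAC [X in X <= _]mulrC ler_wpM2l //.
  exact: ler_norm_sum_sqr.
have q0 := mP x => NN.
have H : N ^+ 2 <= qform e m x * (K * N) by apply: le_trans NN _; rewrite ler_wpM2l.
have [->|Nn0] := eqVneq N 0; first by rewrite mulr0 addr0.
have Np : 0 < N by rewrite lt_def Nn0.
move: H; rewrite expr2 mulrA ler_pM2r // mulNr subr_ge0 => H.
by rewrite mulrC ler_pdivrMr; lra.
Qed.

Lemma eigenvalueE (G : sgraph) (a : R) :
  eigenvalue (adjmx R G) a <-> kernel_vector (@adj G) (- a).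
Proof.
have es := @adj_sym G.
have AE : adjmx R G = relmx (@adj G) by [].
split=> [/eigenvalueP[v vA v0]|[x [[u xu] K]]].
  exists (funof v); split.
    have /rV0Pn[i vi] := v0; by exists (enum_val i); rewrite /funof enum_valK.
  move=> w; have := congr1 (fun m : 'rV_ _ => m 0 (enum_rank w)) vA.
  by rewrite -{1}(rowofK v) AE rowof_mul // mxE enum_rankK => ->; rewrite mulNr addNr.
apply/eigenvalueP; exists (rowof x).
  apply/rowP => j; rewrite AE rowof_mul // !mxE.
  by apply/eqP; rewrite -subr_eq0 addrC -mulNr K.
by apply/rV0Pn; exists (enum_rank u); rewrite mxE enum_rankK.
Qed.

Lemma is_smallest_eigenvalueE (G : sgraph) (a : R) :
  is_smallest_eigenvalue G a <-> bottom_at (@adj G) (- a).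
Proof.
split=> [[/eigenvalueE aE am]|[aP aK]].
  split=> //; have [x [[u _] _]] := aE.
  have [m [mP mK]] := exists_bottom u (@adj_sym G) (@adj_irr G).
  apply: psd_le mP; rewrite lerNr; apply: am; apply/eigenvalueE.
  by rewrite opprK.
split; first exact/eigenvalueE.
move=> b /eigenvalueE[x [[u xu] /kernel_qform q0]]; rewrite leNgt; apply/negP => ba.
have : - a < - b by rewrite ltrN2.
by move=> /(qform_lt (@adj G) xu); rewrite q0 ltNge aP.
Qed.

End Spectrum.

(** * The plastic number and the two directions *)

Section Main.
Context {R : realType}.

Lemma plastic_root_unique (x y : R) : 1 < x -> x ^+ 3 = x + 1 -> y ^+ 3 = y + 1 -> x = y.
Proof.
move=> x1 x3 y3; apply/eqP; rewrite -subr_eq0.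
have : (x - y) * (x ^+ 2 + x * y + y ^+ 2 - 1) == 0.
  by apply/eqP; transitivity ((x ^+ 3 - x) - (y ^+ 3 - y)); [ring|rewrite x3 y3; ring].
rewrite mulf_eq0 => /orP[//|/eqP H].
(* The quadratic factor is [(y + x/2)^2 + 3/4 x^2 - 1]. *)
have x43 : 4 / 3 < x ^+ 2 by nra.
have : 0 <= (y + x / 2) ^+ 2 by apply: sqr_ge0.
lra.
Qed.

Lemma exists_plastic : exists2 x : R, 1 < x & x ^+ 3 = x + 1.
Proof.
pose p : {poly R} := 'X^3 - 'X - 1.
have pE x : p.[x] = x ^+ 3 - x - 1 by rewrite /p !hornerE.
have [||x /andP[x1 _]] := @poly_ivt R p 1 2; first by rewrite ler1n.
  by rewrite !pE; apply/andP; split; lra.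
rewrite rootE pE => /eqP px; exists x; last lra.
by rewrite lt_def x1 andbT; apply/eqP => xE; move: px; rewrite xE; lra.
Qed.

Lemma plastic_bounds (s : R) : 1 < s -> s ^+ 6 = s ^+ 2 + 1 ->
  [/\ 43 / 50 <= s^-1, s + s^-1 = s ^+ 5 & s + s^-1 <= 101 / 50].
Proof.
move=> s1 s6; have s0 : 0 < s by lra.
have y1 : 1 < s ^+ 2 by rewrite expr2; nra.
have y3 : (s ^+ 2) ^+ 3 = s ^+ 2 + 1 by rewrite -exprM.
(* [s^10 = rho^2 + rho + 1], about 4.0796, must be kept below [(101/50)^2 = 4.0804]; this dictates
   the precision of the bound on [rho]. *)
have yb : s ^+ 2 < 13249 / 10000 by move: (s ^+ 2) y1 y3 => y; nra.
have sE : s + s^-1 = s ^+ 5.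
  apply: (mulfI (lt0r_neq0 s0)); rewrite mulrDr mulfV ?gt_eqF // -exprS s6; ring.
split=> //.
  by rewrite -[s^-1]mul1r ler_pdivlMr //; nra.
rewrite sE; have e10 : (s ^+ 5) ^+ 2 = (s ^+ 2) ^+ 2 + s ^+ 2 + 1.
  transitivity ((s ^+ 2) ^+ 2 * (s ^+ 2) ^+ 3); first by ring.
  by rewrite y3 mulrDr mulr1 -exprSr y3; ring.
have : (s ^+ 5) ^+ 2 <= (101 / 50) ^+ 2.
  by rewrite e10; move: (s ^+ 2) y1 yb => y; nra.
by rewrite ler_pXn2r // nnegrE ?exprn_ge0 //; lra.
Qed.

Lemma exists_finite_bottoms (s l : R) : 1 < s -> s ^+ 6 = s ^+ 2 + 1 -> 2 < l -> l < s + s^-1 ->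
  exists V : set R, finite_set V /\
    forall (T : finType) (e : rel T) (m : R), symmetric e -> irreflexive e ->
      bottom_at e m -> 2 < m -> m <= l -> V m.
Proof.
move=> s1 s6 l2 ls; have [s43 sE s101] := plastic_bounds s1 s6.
have [|N HN] := exists_heavy_vertex 6 s1 l2 ls; first by lra.
exists (\bigcup_(n in `I_N.+1) \bigcup_(E in [set: {ffun 'I_n * 'I_n -> bool}])
   [set m | bottom_at (fun i j => E (i, j)) m]).
split.
  apply: bigcup_finite => [|n _]; first exact: finite_II.
  apply: bigcup_finite => [|E _]; first exact: finite_finset.
  have [[m mb]|nb] := pselect (exists m, bottom_at (fun i j => E (i, j)) (m : R)).
    apply: (sub_finite_set _ (finite_set1 m)) => m' /= m'b.
    exact: bottom_unique m'b mb.
  by apply: (sub_finite_set _ (finite_set0 R)) => m' /= m'b; case: nb; exists m'.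
move=> T e m es ei mb m2 ml; have [C [[CP CK] Cc]] := exists_component es mb.
have rs : symmetric (induced_rel e C) by move=> i j; apply: es.
have ri : irreflexive (induced_rel e C) by move=> i; apply: ei.
have CN : (#|C| <= N)%N.
  rewrite leqNgt; apply/negP => NC.
  have : psd (induced_rel e C) (2 : R).
    (* Heaviness is used at [l] and not at [m], so that one [N] serves every [m <= l]. *)
    apply: (@large_psd2 R _ _ s l) => //; try lra.
    move=> F F0 F6; apply: HN => //; last by rewrite card_ord.
    exact: psd_le ml CP.
  have [x [[u xu] /kernel_qform q0]] := CK.
  by move=> /(_ x); rewrite leNgt -q0 (qform_lt _ xu m2).
exists #|C| => //=; exists [ffun p => induced_rel e C p.1 p.2] => //=.
rewrite (_ : (fun i j => _) = induced_rel e C) //.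
by apply/funext => i; apply/funext => j; rewrite ffunE.
Qed.

Lemma dense_bottoms (s l d : R) : 1 < s -> s ^+ 6 = s ^+ 2 + 1 -> s + s^-1 <= l -> 0 < d ->
  exists (G : sgraph) (m : R), bottom_at (@adj G) m /\ l - d <= m <= l + d.
Proof.
move=> s1 s6 sl d0; have [k [k0 lk kl Gk]] := approx_self s1 s6 sl d0.
have [|T [e [es ei P [x xneg]]]] := gadget_near k0 d0 _ Gk.
  by rewrite ger0_norm; lra.
have [u _] : exists u, x u != 0.
  apply/existsP; apply: contraLR xneg => /existsPn x0.
  rewrite -leNgt /qform /bform big1 // => u _.
  by move: (x0 u); rewrite negbK => /eqP ->; rewrite mul0r.
have [m [mP mK]] := exists_bottom (R := R) u es ei.
exists (SGraph es ei), m; split=> //; apply/andP; split.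
  rewrite leNgt; apply/negP => /ltW ml.
  by have := psd_le ml mP x; rewrite leNgt xneg.
rewrite leNgt; apply/negP => lm; have [y [[v yv] /kernel_qform q0]] := mK.
by have := qform_lt e yv lm; rewrite q0 ltNge P.
Qed.

End Main.

Theorem corollary1p4 (R : realType) :
  exists rho : R,
    unique (fun x : R => x ^+ 3 = x + 1) rho /\
    forall lambda : R, 2 < lambda ->
      (limit_point (@smallest_eigenvalues R) (- lambda) <->
       lambda_star rho <= lambda).
Proof.
have [rho rho1 rho3] := @exists_plastic R; exists rho; split.
  by split=> // y y3; apply: plastic_root_unique.
pose s := Num.sqrt rho; have rho0 : 0 <= rho by lra.
have s2 : s ^+ 2 = rho by rewrite sqr_sqrtr.
have s1 : 1 < s by rewrite -[1]sqrtr1 ltr_sqrt //; lra.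
have s6 : s ^+ 6 = s ^+ 2 + 1 by rewrite (exprM s 2 3) s2.
have -> : lambda_star rho = s + s^-1 by rewrite /lambda_star powRN powR12_sqrt.
move=> l l2; split=> [lim|sl].
  rewrite leNgt; apply/negP => ls.
  (* The midpoint leaves room on both sides of [l]: finitely many bottoms in []2, m]] cannot
     accumulate at [l]. *)
  pose m := (l + (s + s^-1)) / 2.
  have [||V [Vfin VP]] := @exists_finite_bottoms R s m s1 s6; rewrite /m; try lra.
  pose W := (-%R @` V) `\ (- l).
  have Wcl : closed W.
    have /accessible_finite_set_closed := hausdorff_accessible (@Rhausdorff R).
    by apply; apply: finite_setD; apply: finite_image.
  have d0 : 0 < Num.min (l - 2) (m - l) by rewrite lt_min /m; apply/andP; split; lra.
  have [|y [yl [G Gy] [yW yd]]] := lim (~` W `&` ball (- l) (Num.min (l - 2) (m - l))).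
    apply: filterI; last exact: nbhsx_ballx.
    apply: open_nbhs_nbhs; split; first exact: closed_openC.
    by move=> [_]; apply.
  apply: yW; split; last by move/eqP: yl.
  exists (- y); last by rewrite opprK.
  move/is_smallest_eigenvalueE: Gy => Gb.
  move: yd; rewrite /ball /= lt_min !ltr_norml => /andP[/andP[h1 h2] /andP[h3 h4]].
  by apply: (VP _ _ _ (@adj_sym G) (@adj_irr G) Gb); rewrite -/m; lra.
move=> U /nbhs_ballP[d /= d0 dU].
(* Aiming at [l + d/2] with error [d/4] gives a point within [d] of [l] yet different from it. *)
have sl' : s + s^-1 <= l + d / 2 by lra.
have d4 : 0 < d / 4 by lra.
have [G [m [Gm /andP[m1 m2]]]] := dense_bottoms s1 s6 sl' d4.
exists (- m); split; first by rewrite eqr_opp; apply/eqP; lra.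
  by exists G; apply/is_smallest_eigenvalueE; rewrite opprK.
by apply: dU; rewrite /ball /= ltr_norml; apply/andP; split; lra.
Qed.
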